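(* Let $I_k$ be a sequence of uniformly elliptic operators with respect to $\mathcal L_0=\mathcal L_0(\sigma,\Lambda)$. Let $\{u_k\}_{k\ge1}$ be a sequence of functions in $C(-T,0;L^1(\omega))$ that are lower semicontinuous in $\bar\Omega\times(-T,0]$, such that (i) $(u_k)_t-I_ku_k\ge f_k$ in the viscosity sense in $\Omega\times(-T,0]$; (ii) $u_k\to u$ in the $\Gamma$ sense in $\Omega\times(-T,0]$ and in $C(-T,0;L^1(\omega))$; (iii) $f_k\to f$ locally uniformly in $\Omega\times(-T,0]$; (iv) $I_k\to I$ weakly in $\Omega\times(-T,0]$ (with respect to $\omega$); (v) there is $C$ such that $|u_k(x,t)|\le C$ for every $k$ and every $(x,t)\in\Omega\times(-T,0]$. Then also $u_t-Iu\ge f$ in the viscosity sense in $\Omega\times(-T,0]$.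
   Context: $\sigma\in(0,2)$, $\Lambda\ge1$, $\Omega\subseteq\mathbb R^n$ is a domain, $T>0$. $\delta(u,x,t;y)=u(x+y,t)+u(x-y,t)-2u(x,t)$. $\mathcal L_0(\sigma,\Lambda)$ is the set of linear operators $Lu(x,t)=\int_{\mathbb R^n}\delta(u,x,t;y)K(y)\,dy$ with $K$ even and $(2-\sigma)\Lambda^{-1}|y|^{-n-\sigma}\le K(y)\le(2-\sigma)\Lambda|y|^{-n-\sigma}$; $\mathcal M^+_{\mathcal L_0}v=\sup_{L\in\mathcal L_0}Lv$, $\mathcal M^-_{\mathcal L_0}v=\inf_{L\in\mathcal L_0}Lv$. An operator $I$ is elliptic with respect to $\mathcal L_0$ if $\mathcal M^-_{\mathcal L_0}(u-v)\le Iu-Iv\le\mathcal M^+_{\mathcal L_0}(u-v)$ at every point of its domain. $\omega(y)=1/(1+|y|^{n+\sigma})$; $L^1(\omega)$ is the space of functions integrable against $\omega$. $C(a,b;L^1(\omega))$ is the space of functions $u$ on $\mathbb R^n\times(a,b]$ such that $u(\cdot,t)\in L^1(\omega)$ for all $t\in(a,b]$ and $\|u(\cdot,t_1)-u(\cdot,t_2)\|_{L^1(\omega)}\to0$ as $t_1\to t_2^-$ for every $t_2\in(a,b]$, with norm $\sup_{t\in(a,b]}\|u(\cdot,t)\|_{L^1(\omega)}$. Semicontinuity and continuity are with respect to the parabolic topology, where neighbourhoods of $(x,t)$ are $B_r(x)\times(t-\tau,t]$; $(x_k,t_k)\to(x,t^-)$ denotes convergence with $t_k\le t$. The set $S$ of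 test functions consists of the pairs $(v,B_r(x)\times(t-\tau,t])$ with $B_r(x)\times(t-\tau,t]\subseteq\Omega\times(-T,0]$, $v\in C(t-\tau,t;L^1(\omega))$ and $v$ equal on $B_r(x)\times(t-\tau,t]$ to a polynomial $\sum a_{ij}x_ix_j+\sum b_ix_i+ct+d$. An operator $I$ is continuous if for each such pair $Iv$ is continuous in $B_r(x)\times(t-\tau,t]$. Viscosity supersolution: $u_t-Iu\ge f$ in $\Omega\times(-T,0]$ if, whenever $(v,B_r(x)\times(t-\tau,t])\in S$ satisfies $v(x,t)=u(x,t)$, $v<u$ on $B_r(x)\times(t-\tau,t]\setminus\{(x,t)\}$ and $v=u$ on $(\mathbb R^n\setminus B_r(x))\times(t-\tau,t]$, one has $v_{t^-}(x,t)-Iv(x,t)\ge f(x,t)$, where $v_{t^-}(x,t)=\lim_{h\to0^+}(v(x,t)-v(x,t-h))/h$. $\Gamma$-convergence: lower semicontinuous $u_k$ $\Gamma$-converge to $u$ in $\Omega\times(-T,0]$ if (i) for every sequence $(x_k,t_k)\to(x,t^-)$ in $\Omega\times(-T,0]$, $\liminf_{k\to\infty}u_k(x_k,t_k)\ge u(x,t)$; (ii) for every $(x,t)\in\Omega\times(-T,0]$ there is a sequence $(x_k,t_k)\to(x,t^-)$ in $\Omega\times(-T,0]$ with $\limsup_{k\to\infty}u_k(x_k,t_k)=u(x,t)$. Weak convergence of operators: a sequence $\{I_k\}$ of continuous operators in $\Omega\times(-T,0]$ converges weakly to $I$ if for every $(v,B_r(x)\times(t-\tau,t])\in S$, $I_kv\to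 Iv$ uniformly in $B_{r/2}(x)\times(t-\tau/2,t]$.
   Formalization: Two hypotheses are added, without which the claim is false: each u_k is also lower semicontinuous in Ω×(-T,0] for the usual Euclidean topology (not only the parabolic one), and the limit right-hand side f is continuous in Ω×(-T,0] for the parabolic topology. *)

(* Defs.v *)
From HB Require Import structures.
From mathcomp Require Import all_boot all_order all_algebra.
From mathcomp Require Import all_classical all_reals all_analysis.

Set Implicit Arguments.
Unset Strict Implicit.
Unset Printing Implicit Defensive.

Import Order.TTheory GRing.Theory Num.Theory.
Import numFieldNormedType.Exports.

Local Open Scope classical_set_scope.
Local Open Scope ring_scope.

(* Lebesgue measure on R^n, as the n-fold product of the Lebesgue measure on R.
   It lives on n-tuples, whose sigma-algebra is generated by the coordinates. *)

Section cons_measure.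
Context {R : realType} (n : nat).
Variable m : {sigma_finite_measure set (n.-tuple (measurableTypeR R)) -> \bar R}.

Definition tuple_cons (p : measurableTypeR R * n.-tuple (measurableTypeR R)) :
  n.+1.-tuple (measurableTypeR R) := [tuple of p.1 :: p.2].

Lemma measurable_tuple_cons : measurable_fun setT tuple_cons.
Proof. exact: measurable_cons. Qed.

Definition cons_measure : set (n.+1.-tuple (measurableTypeR R)) -> \bar R :=
  pushforward (@lebesgue_measure R \x m)%E tuple_cons.

Let cons_measure0 : cons_measure set0 = 0%E.
Proof. by rewrite /cons_measure /pushforward preimage_set0 measure0. Qed.

Let cons_measure_ge0 A : (0 <= cons_measure A)%E.
Proof. by rewrite /cons_measure /pushforward; exact: measure_ge0. Qed.

Let cons_measure_sigma_additive : semi_sigma_additive cons_measure.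
Proof.
move=> F mF tF mUF; rewrite /cons_measure /pushforward preimage_bigcup.
have mpre A : measurable A -> measurable (tuple_cons @^-1` A).
  by move=> mA; rewrite -[X in measurable X]setTI; exact: measurable_tuple_cons.
apply: measure_semi_sigma_additive.
- by move=> i; exact: mpre.
- apply/trivIsetP => /= i j _ _ ij; rewrite -preimage_setI.
  by move/trivIsetP : tF => /(_ _ _ _ _ ij) ->//; rewrite preimage_set0.
- by rewrite -preimage_bigcup; exact: mpre.
Qed.

HB.instance Definition _ := isMeasure.Build _ _ _ cons_measure
  cons_measure0 cons_measure_ge0 cons_measure_sigma_additive.

Let tuple_uncons (t : n.+1.-tuple (measurableTypeR R)) :
  measurableTypeR R * n.-tuple (measurableTypeR R) :=
  (tnth t ord0, [tuple of behead t]).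

Let tuple_consK : cancel tuple_cons tuple_uncons.
Proof.
move=> [x t]; rewrite /tuple_uncons /tuple_cons/=; congr pair.
exact/val_inj.
Qed.

Let measurable_tuple_uncons : measurable_fun setT tuple_uncons.
Proof.
apply: measurable_fun_pair; first exact: measurable_tnth.
exact: measurable_behead.
Qed.

Let cons_measure_sigma_finite : sigma_finite setT cons_measure.
Proof.
have /sigma_finiteP[F [FT ndF Foo]] := sigma_finiteT (@lebesgue_measure R).
have /sigma_finiteP[G [GT ndG Goo]] := sigma_finiteT m.
exists (fun i => tuple_uncons @^-1` (F i `*` G i)).
  apply/esym; rewrite -subTset => t _.
  have : [set: measurableTypeR R] (tuple_uncons t).1 by [].
  have : [set: n.-tuple (measurableTypeR R)] (tuple_uncons t).2 by [].
  rewrite FT GT => -[j _ Gj] [i _ Fi]; exists (maxn i j) => //; split.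
  - by move: Fi; exact/subsetPset/ndF/leq_maxl.
  - by move: Gj; exact/subsetPset/ndG/leq_maxr.
move=> i; have [mF Fi] := Foo i; have [mG Gi] := Goo i; split.
  rewrite -[X in measurable X]setTI; apply: measurable_tuple_uncons => //.
  exact: measurableX.
rewrite /cons_measure /pushforward -comp_preimage.
rewrite (_ : _ \o _ = id) ?preimage_id; last first.
  by apply/funext => p /=; exact: tuple_consK.
by rewrite product_measure1E// lte_mul_pinfty// ge0_fin_numE.
Qed.

HB.instance Definition _ := Measure_isSigmaFinite.Build _ _ _ cons_measure
  cons_measure_sigma_finite.

End cons_measure.

Fixpoint lebesgue_tuple (R : realType) (n : nat) :
    {sigma_finite_measure set (n.-tuple (measurableTypeR R)) -> \bar R} :=
  match n with
  | 0%N => \d_ ([tuple] : 0.-tuple (measurableTypeR R))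
  | n'.+1 => cons_measure (lebesgue_tuple R n')
  end.

Definition vec (R : realType) (n : nat) (y : n.-tuple (measurableTypeR R)) :
  'rV[R]_n := \row_i (tnth y i : R).

Section nonlocal_parabolic.
Context {R : realType} {n : nat}.
Implicit Types (x : 'rV[R]_n) (p q : 'rV[R]_n * R) (r t tau : R).
Implicit Types (u v f : 'rV[R]_n * R -> R).

Local Notation spacetime := ('rV[R]_n * R)%type.
Local Notation mu := (lebesgue_tuple R n).

(* The norm of 'rV[R]_n is the sup norm, hence an explicit Euclidean norm. *)
Definition enorm x : R := Num.sqrt (\sum_(i < n) x ord0 i ^+ 2).

(* B_r(x) x (t - tau, t] *)
Definition pcyl x r t tau : set spacetime :=
  [set q | enorm (q.1 - x) < r /\ t - tau < q.2 <= t].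

(* Neighbourhood filters of the parabolic topology. *)
Definition pnbhs p : set_system spacetime :=
  filter_from [set e : R * R | 0 < e.1 /\ 0 < e.2]
              (fun e => pcyl p.1 e.1 p.2 e.2).

Definition pcontinuous_on (A : set spacetime) u : Prop :=
  forall p, A p -> u @ within A (pnbhs p) --> u p.

(* Lower semicontinuity on A, relative to a family N of neighbourhood filters:
   N is pnbhs for the parabolic topology and nbhs for the Euclidean one.
   Parabolic lower semicontinuity allows instantaneous drops in time, and these
   destroy stability: the left-continuous sawtooth functions
   u_k(x, t) = t - (ceil(k t) - 1) / k solve (u_k)_t - I u_k >= 1 in the
   one-sided viscosity sense for I = L \in L_0, and converge uniformly to 0. *)
Definition lsc_on (N : spacetime -> set_system spacetime) (A : set spacetime) u
    : Prop :=
  forall p, A p -> forall a, a < u p -> within A (N p) [set q | a < u q].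

Section integro_differential.
Variables sigma Lambda : R.

Definition omega (y : 'rV[R]_n) : R := (1 + enorm y `^ (n%:R + sigma))^-1.

Definition L1omega (g : 'rV[R]_n -> R) : Prop :=
  mu.-integrable setT (fun y => (g (vec y) * omega (vec y))%:E).

Definition L1omega_norm (g : 'rV[R]_n -> R) : \bar R :=
  (\int[mu]_y (`|g (vec y)| * omega (vec y))%:E)%E.

(* u \in C(a,b;L^1(omega)); only the values of u on R^n x (a, b] matter. *)
Definition C_L1omega (a b : R) u : Prop :=
  (forall t, a < t <= b -> L1omega (fun y => u (y, t))) /\
  (forall t2, a < t2 <= b ->
    L1omega_norm (fun y => u (y, t1) - u (y, t2)) @[t1 --> t2^'-] --> 0%E).

Definition cvg_C_L1omega (a b : R) (u_ : nat -> spacetime -> R) u : Prop :=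
  ereal_sup [set L1omega_norm (fun y => u_ k (y, t) - u (y, t)) |
              t in `]a, b]] @[k --> \oo] --> 0%E.

Definition delta u p (y : 'rV[R]_n) : R :=
  u (p.1 + y, p.2) + u (p.1 - y, p.2) - 2 * u p.

Definition kernel_class (K : 'rV[R]_n -> R) : Prop :=
  [/\ measurable_fun setT (fun y => K (vec y)),
      (forall y, K (- y) = K y) &
      (forall y, y != 0 ->
        (2 - sigma) * Lambda^-1 * enorm y `^ (- (n%:R + sigma)) <= K y
          <= (2 - sigma) * Lambda * enorm y `^ (- (n%:R + sigma)))].

Definition integral_operator (K : 'rV[R]_n -> R) u p : \bar R :=
  (\int[mu]_y (delta u p (vec y) * K (vec y))%:E)%E.

Definition L0 : set ((spacetime -> R) -> spacetime -> \bar R) :=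
  [set integral_operator K | K in kernel_class].

Definition Mplus v p : \bar R := ereal_sup [set L v p | L in L0].

Definition Mminus v p : \bar R := ereal_inf [set L v p | L in L0].

Section operators.
Variables (Omega : set 'rV[R]_n) (T : R).

Definition pdom : set spacetime := Omega `*` `]- T, 0].

Definition quadratic_on (A : set spacetime) v : Prop :=
  exists (a : 'M[R]_n) (b : 'rV[R]_n) (c d : R), forall q, A q ->
    v q = \sum_(i < n) \sum_(j < n) a i j * q.1 ord0 i * q.1 ord0 j
          + \sum_(i < n) b ord0 i * q.1 ord0 i + c * q.2 + d.

(* The pair (v, B_r(x) x (t - tau, t]) belongs to S. *)
Definition test_pair v x r t tau : Prop :=
  [/\ 0 < r, 0 < tau, pcyl x r t tau `<=` pdom,
      C_L1omega (t - tau) t v & quadratic_on (pcyl x r t tau) v].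

(* An operator acts on the functions v of the pairs of S, and the points where
   I v is considered are those of the cylinders of these pairs. Functions are
   extended arbitrarily outside R^n x (t - tau, t]: an elliptic I does not see
   the extension, since delta only involves the time slice of the point. *)
Definition operator := (spacetime -> R) -> spacetime -> R.

Definition in_domain v p : Prop :=
  exists x r t tau, test_pair v x r t tau /\ pcyl x r t tau p.

Definition elliptic (I : operator) : Prop :=
  forall u v p, in_domain u p -> in_domain v p ->
    (Mminus (u \- v)%R p <= (I u p - I v p)%:E <= Mplus (u \- v)%R p)%E.

Definition continuous_operator (I : operator) : Prop :=
  forall v x r t tau, test_pair v x r t tau ->
    pcontinuous_on (pcyl x r t tau) (I v).

Definition weak_cvg (I_ : nat -> operator) (I : operator) : Prop :=
  (forall k, continuous_operator (I_ k)) /\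
  (forall v x r t tau, test_pair v x r t tau ->
    {uniform pcyl x (r / 2) t (tau / 2), (fun k => I_ k v) @ \oo --> I v}).

Definition left_time_derivative v p : R :=
  lim ((v p - v (p.1, p.2 - h)) / h @[h --> 0^'+]).

Definition viscosity_supersolution (I : operator) f u : Prop :=
  forall v x r t tau, test_pair v x r t tau ->
    v (x, t) = u (x, t) ->
    (forall q, pcyl x r t tau q -> q != (x, t) -> v q < u q) ->
    (forall q, r <= enorm (q.1 - x) -> t - tau < q.2 <= t -> v q = u q) ->
    f (x, t) <= left_time_derivative v (x, t) - I v (x, t).

Definition Gamma_cvg (u_ : nat -> spacetime -> R) u : Prop :=
  (forall (z : nat -> spacetime) p, (forall k, pdom (z k)) -> pdom p ->
     z @ \oo --> p -> (forall k, (z k).2 <= p.2) ->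
     ((u p)%:E <= limn_einf (fun k => (u_ k (z k))%:E))%E) /\
  (forall p, pdom p -> exists z : nat -> spacetime,
     [/\ (forall k, pdom (z k)), z @ \oo --> p, (forall k, (z k).2 <= p.2) &
         limn_esup (fun k => (u_ k (z k))%:E) = (u p)%:E]).

Definition cvg_locally_uniformly (f_ : nat -> spacetime -> R) f : Prop :=
  forall C : set spacetime, compact C -> C `<=` pdom ->
    {uniform C, f_ @ \oo --> f}.

End operators.
End integro_differential.
End nonlocal_parabolic.

(* Main.v *)
(* Let [v] touch [u] strictly from below at [(x, t)], with [v] quadratic near
   [(x, t)]. One minimizes [u_ k - v] on a small closed cylinder, uses the
   inequality for [u_ k] at a minimum point and lets [k] tend to infinity.

   - The liminf inequality of Gamma convergence only concerns sequences coming
     from the past, whereas minimum points may approach a limit from the future.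
     A barrier decreasing fast in time shows that supersolutions cannot drop
     instantaneously, hence that the liminf inequality also holds from the
     future, near [(x, t)], where [f_ k] and [I_ k v] are bounded below thanks
     to their parabolic continuity at [(x, t)].
   - At a touching point the test function for [u_ k] is compared with [v]
     itself: since [v <= u], their difference is at least [- |u_ k - u|] away
     from the touching point, so ellipticity bounds the error by the
     [L1omega_norm] of [u_ k - u] and small local terms.
   - The truncated second moment of the kernels is finite merely because
     the operators are real valued: compare [v] and [v + r^2 - |y - x|^2] in the
     ellipticity inequality at [(x, t)]. *)

Require Import Defs.
From mathcomp Require Import all_boot all_order all_algebra.
From mathcomp Require Import all_classical all_reals all_analysis.
From mathcomp Require Import measurable_realfun ring lra.

Import Order.TTheory GRing.Theory Num.Theory.
Import numFieldNormedType.Exports.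

Local Open Scope classical_set_scope.
Local Open Scope ring_scope.

(** * Lebesgue measure on tuples *)

(** The integral of a nonnegative function is a supremum over the nonnegative simple functions below
    it, and this family grows with the function. *)
Lemma le_integralT {d} {T : measurableType d} {R : realType}
    (mu : {measure set T -> \bar R}) (f g : T -> \bar R) :
  (forall x, 0 <= f x)%E -> (forall x, f x <= g x)%E ->
  (\int[mu]_x f x <= \int[mu]_x g x)%E.
Proof.
move=> f0 fg; have g0 x : (0 <= g x)%E by exact: le_trans (fg x).
rewrite !ge0_integralTE//; apply: ereal_sup_le => _ [h hf <-].
by exists h => // x; exact: le_trans (fg x).
Qed.

Section lebesgue_tuple_theory.
Context {R : realType}.
Local Notation M := (measurableTypeR R).
Local Notation lambda := (@lebesgue_measure R).

Definition preserves_lebesgue (phi : M -> M) : Prop :=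
  measurable_fun setT phi /\
  forall A, measurable A -> lambda (phi @^-1` A) = lambda A.

(** The pushforward under the translation agrees with Lebesgue measure on half-open intervals, which
    determine the measure. *)
Lemma preserves_lebesgueD (c : R) : preserves_lebesgue (fun x => c + x).
Proof.
have mc : measurable_fun setT ((fun x => c + x) : M -> M).
  by apply: measurable_funD.
split=> // A mA; apply/esym.
apply: (@lebesgue_measure_unique R
  (pushforward lambda ((fun x => c + x) : M -> M))) => //= _ [[a b]] _ <-.
rewrite /pushforward.
rewrite (_ : _ @^-1` _ = `]a - c, b - c]%classic).
  by rewrite !lebesgue_measure_itv/= !lte_fin ltrD2r -!EFinB opprB addrA subrK.
by apply/seteqP; split => x /=; rewrite !in_itv/= ltrBlDl lerBrDl.
Qed.

Lemma preserves_lebesgueB (c : R) : preserves_lebesgue (fun x => c - x).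
Proof.
have [mD lD] := preserves_lebesgueD c.
have mN : measurable_fun setT (-%R : M -> M) by exact: oppr_measurable.
split=> [|A mA]; first exact: (measurableT_comp mD mN).
rewrite -[RHS]lD// -[RHS]lebesgue_measureN//.
by have := mD measurableT A mA; rewrite setTI.
Qed.

Lemma integral_preserves_lebesgue (phi : M -> M) (f : M -> \bar R) :
  preserves_lebesgue phi -> measurable_fun setT f -> (forall x, 0 <= f x)%E ->
  (\int[lambda]_x f (phi x) = \int[lambda]_x f x)%E.
Proof.
move=> [mphi lphi] mf f0.
rewrite -[LHS](@ge0_integral_pushforward _ _ _ _ _ phi mphi lambda setT f)//.
by apply: eq_measure_integral => A mA _; exact: lphi.
Qed.

Lemma integral_lebesgue_tupleS n (F : n.+1.-tuple M -> \bar R) :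
  measurable_fun setT F -> (forall t, 0 <= F t)%E ->
  (\int[lebesgue_tuple R n.+1]_t F t =
   \int[lambda]_x \int[lebesgue_tuple R n]_t F (tuple_cons (x, t)))%E.
Proof.
move=> mF F0.
transitivity (\int[pushforward (lambda \x lebesgue_tuple R n)%E
                     (@tuple_cons R n)]_t F t)%E; first by [].
rewrite ge0_integral_pushforward//; last exact: measurable_tuple_cons.
rewrite preimage_setT fubini_tonelli1//=.
exact: (measurableT_comp mF (@measurable_tuple_cons R n)).
Qed.

Definition tuple_apply {n} (phi : 'I_n -> M -> M) (t : n.-tuple M) :
  n.-tuple M := [tuple phi i (tnth t i) | i < n].

Lemma measurable_tuple_apply n (phi : 'I_n -> M -> M) :
  (forall i, measurable_fun setT (phi i)) ->
  measurable_fun setT (tuple_apply phi).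
Proof.
move=> mphi; apply/measurable_fun_tnthP => i.
rewrite (_ : _ \o _ = phi i \o (fun t => tnth t i)).
  by apply: measurableT_comp; [exact: mphi|exact: measurable_tnth].
by apply/funext => t /=; rewrite tnth_mktuple.
Qed.

(** Induction on [n]: Tonelli splits off the first coordinate, the induction hypothesis treats the
    others under the integral sign, and [phi ord0] preserves [lambda]. Translations and reflections
    of R^n act coordinatewise, so this yields their invariance. *)
Lemma integral_tuple_apply n (phi : 'I_n -> M -> M) (F : n.-tuple M -> \bar R) :
  (forall i, preserves_lebesgue (phi i)) ->
  measurable_fun setT F -> (forall t, 0 <= F t)%E ->
  (\int[lebesgue_tuple R n]_t F (tuple_apply phi t) =
   \int[lebesgue_tuple R n]_t F t)%E.
Proof.
elim: n => [|n IH] in phi F *.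
  by move=> _ _ _; apply: eq_integral => t _; rewrite (tuple0 t) (tuple0 (tuple_apply _ _)).
move=> pphi mF F0.
have mphi i : measurable_fun setT (phi i) by case: (pphi i).
rewrite !integral_lebesgue_tupleS//; last first.
  exact: (measurableT_comp mF (measurable_tuple_apply _ phi mphi)).
have mFc : measurable_fun setT (F \o @tuple_cons R n).
  exact: (measurableT_comp mF (@measurable_tuple_cons R n)).
pose phi' i := phi (lift ord0 i).
have consE x t : tuple_apply phi (tuple_cons (x, t)) =
    tuple_cons (phi ord0 x, tuple_apply phi' t).
  apply: eq_from_tnth => i; rewrite tnth_mktuple.
  case: (unliftP ord0 i) => [j ->|->]; last by rewrite !tnth0.
  by rewrite !tnthS tnth_mktuple.
under eq_integral => x _.
  under eq_integral do rewrite consE.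
  rewrite (IH phi' (fun t => F (tuple_cons (phi ord0 x, t))))//; last first.
  - exact: (@measurable_fun_pair2 _ _ _ _ _ _ _ (phi ord0 x) mFc).
  - by move=> i; exact: pphi.
  over.
apply: (integral_preserves_lebesgue (phi ord0)
  (fun x => \int[lebesgue_tuple R n]_t F (tuple_cons (x, t))))%E => //.
- by apply: (measurable_fun_fubini_tonelli_F (F \o @tuple_cons R n)) => // t; exact: F0.
- by move=> x; apply: integral_ge0 => t _; exact: F0.
Qed.

(** Cubes are products of intervals, so their measure is accessible by induction on [n]; Euclidean
    balls are enclosed in them. *)
Definition cube n (r : R) : set (n.-tuple M) := [set t | forall i, `|tnth t i| <= r].

Lemma measurable_cube n r : measurable (cube n r).
Proof.
rewrite (_ : cube n r =
    \bigcap_(i in [set: 'I_n]) ((fun t => tnth t i) @^-1` `[- r, r]%classic)).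
  apply: fin_bigcap_measurable => // i _.
  have := @measurable_tnth _ M n i measurableT `[- r, r]%classic.
  by rewrite setTI; apply; exact: measurable_itv.
apply/seteqP; split => [t tr i _|t tr i] /=.
  by rewrite in_itv/= -ler_norml; exact: tr.
by rewrite ler_norml; have := tr i Logic.I; rewrite /= in_itv.
Qed.

Lemma lebesgue_tuple_cube_lty n r : (lebesgue_tuple R n (cube n r) < +oo)%E.
Proof.
elim: n => [|n IH] /=.
  by rewrite diracE; case: (_ \in _); rewrite ltry.
rewrite /cons_measure /pushforward.
rewrite (_ : _ @^-1` _ = `[- r, r]%classic `*` cube n r); last first.
  apply/seteqP; split => [[x t] /= tr|[x t] /= [xr tr] i].
    split.
      by have := tr ord0; rewrite tnth0 /= in_itv/= -ler_norml.
    by move=> i /=; have := tr (lift ord0 i); rewrite tnthS.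
  case: (unliftP ord0 i) => [j ->|->]; first by rewrite tnthS.
  by rewrite tnth0/= ler_norml; move: xr; rewrite /= in_itv.
rewrite product_measure1E//; [|exact: measurable_cube].
have rr_lty : (lambda `[(- r)%R, r]%classic < +oo)%E.
  by rewrite lebesgue_measure_itv/=; case: ifP; rewrite -?EFinD ltry.
by apply: lte_mul_pinfty => //; rewrite ge0_fin_numE//; exact: rr_lty.
Qed.

End lebesgue_tuple_theory.

(** * Euclidean norm and quadratic polynomials *)

Section enorm_theory.
Context {R : realType} {n : nat}.
Implicit Types (x y : 'rV[R]_n).

Lemma enorm_ge0 x : 0 <= enorm x.
Proof. exact: sqrtr_ge0. Qed.

Lemma enorm_sqr x : enorm x ^+ 2 = \sum_(i < n) x ord0 i ^+ 2.
Proof. by rewrite sqr_sqrtr// sumr_ge0// => i _; exact: sqr_ge0. Qed.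

Lemma enorm0 : enorm (0 : 'rV[R]_n) = 0.
Proof.
by rewrite /enorm big1 ?sqrtr0// => i _; rewrite mxE expr0n.
Qed.

Lemma enormN x : enorm (- x) = enorm x.
Proof. by rewrite /enorm; under eq_bigr do rewrite mxE sqrrN. Qed.

Lemma ler_coord_enorm x i : `|x ord0 i| <= enorm x.
Proof.
rewrite -sqrtr_sqr ler_wsqrtr// (bigD1 i)//= lerDl.
by apply: sumr_ge0 => j _; exact: sqr_ge0.
Qed.

Lemma enorm_eq0 x : enorm x = 0 -> x = 0.
Proof.
move=> x0; apply/rowP => i; rewrite mxE; apply/eqP; rewrite -normr_eq0.
by rewrite eq_le normr_ge0 andbT -x0 ler_coord_enorm.
Qed.

Lemma enorm_gt0 x : x != 0 -> 0 < enorm x.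
Proof.
by move=> x0; rewrite lt_def enorm_ge0 andbT; apply: contraNneq x0 => /enorm_eq0 ->.
Qed.

(** Cauchy-Schwarz: a sum of squares expands to 2 |x| |y| times the difference of the two sides, and
    this factor is positive unless a vector vanishes. *)
Lemma enorm_dot_le x y :
  \sum_(i < n) x ord0 i * y ord0 i <= enorm x * enorm y.
Proof.
have [/enorm_eq0 ->|x0] := eqVneq (enorm x) 0.
  by rewrite big1 ?enorm0 ?mul0r// => i _; rewrite mxE mul0r.
have [/enorm_eq0 ->|y0] := eqVneq (enorm y) 0.
  by rewrite big1 ?enorm0 ?mulr0// => i _; rewrite mxE mulr0.
have xy0 : 0 < enorm x * enorm y by rewrite mulr_gt0// lt_def ?x0 ?y0 enorm_ge0.
have : 0 <= \sum_(i < n) (enorm y * x ord0 i - enorm x * y ord0 i) ^+ 2.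
  by apply: sumr_ge0 => i _; exact: sqr_ge0.
set S := \sum_(i < n) x ord0 i * y ord0 i.
have -> : \sum_(i < n) (enorm y * x ord0 i - enorm x * y ord0 i) ^+ 2 =
    enorm y ^+ 2 * (\sum_(i < n) x ord0 i ^+ 2) - 2 * enorm y * enorm x * S
    + enorm x ^+ 2 * (\sum_(i < n) y ord0 i ^+ 2).
  rewrite !mulr_sumr -sumrB -big_split/=.
  by apply: eq_bigr => i _; ring.
rewrite -!enorm_sqr => h; have {}h : 0 <= (enorm x * enorm y) * (enorm x * enorm y - S) by nra.
by rewrite -subr_ge0 -(pmulr_rge0 _ xy0).
Qed.

Lemma enormD x y : enorm (x + y) <= enorm x + enorm y.
Proof.
rewrite -(@ler_pXn2r _ 2)// ?nnegrE ?addr_ge0 ?enorm_ge0//.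
have -> : enorm (x + y) ^+ 2 =
    enorm x ^+ 2 + 2 * (\sum_(i < n) x ord0 i * y ord0 i) + enorm y ^+ 2.
  rewrite !enorm_sqr mulr_sumr -!big_split/=.
  by apply: eq_bigr => i _; rewrite mxE; ring.
by have := enorm_dot_le x y; nra.
Qed.

Lemma enormB x y : enorm (x - y) <= enorm x + enorm y.
Proof. by rewrite -[in leRHS](enormN y) enormD. Qed.

Lemma enorm_parallelogram x y :
  enorm (x + y) ^+ 2 + enorm (x - y) ^+ 2 = 2 * enorm x ^+ 2 + 2 * enorm y ^+ 2.
Proof.
rewrite !enorm_sqr !mulr_sumr -!big_split/=; apply: eq_bigr => i _.
by rewrite !mxE; ring.
Qed.

Lemma continuous_enorm : continuous (@enorm R n).
Proof.
move=> x; apply: (@continuous_comp _ _ _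
  (fun y : 'rV[R]_n => \sum_(i < n) y ord0 i ^+ 2) Num.sqrt).
  apply: continuous_big => [|i _ {}x]; first exact: add_continuous.
  have xi := @coord_continuous R 1 n ord0 i x.
  by under eq_fun do rewrite expr2; exact: (cvgM xi xi).
exact: sqrt_continuous.
Qed.

Lemma ler_norm_enorm x : `|x| <= enorm x.
Proof.
rewrite /Num.norm/= mx_normrE; apply: bigmax_le; first exact: enorm_ge0.
by case=> i j _ /=; rewrite (ord1 i) ler_coord_enorm.
Qed.

(** The topology comes from the sup norm: one direction uses that [enorm] dominates it, the other
    that [enorm] is continuous. *)
Lemma nbhs_enorm_ball (p : 'rV[R]_n * R) (A : set ('rV[R]_n * R)) :
  nbhs p A <-> exists2 e : R, 0 < e &
    forall q, enorm (q.1 - p.1) < e -> `|q.2 - p.2| < e -> A q.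
Proof.
split=> [/nbhs_ballP[e /= e0 eA]|[e e0 eA]].
  exists e => // q q1 q2; apply: eA; split => /=.
    by rewrite -ball_normE/= distrC (le_lt_trans (ler_norm_enorm _)).
  by rewrite -ball_normE/= distrC.
have h1 : \forall y \near p.1, enorm (y - p.1) < e.
  have : (fun y => enorm (y - p.1)) @ p.1 --> enorm (p.1 - p.1).
    apply: (@continuous_comp _ _ _ (fun y : 'rV[R]_n => y - p.1) (@enorm R n)).
      have h : id @ nbhs p.1 --> p.1 by exact: cvg_id.
      exact: (cvgB h (cvg_cst p.1)).
    exact: continuous_enorm.
  by rewrite subrr enorm0 => /cvgr_lt; apply.
have h2 : \forall s \near p.2, `|s - p.2| < e.
  have := nbhsx_ballx p.2 e e0; apply: filterS => s.
  by rewrite -ball_normE/= distrC.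
exists (([set y | enorm (y - p.1) < e], [set s | `|s - p.2| < e])) => //=.
by move=> q [q1 q2]; exact: eA.
Qed.

End enorm_theory.

Section quadratics.
Context {R : realType} {n : nat}.
Local Notation spacetime := ('rV[R]_n * R)%type.
Implicit Types (a : 'M[R]_n) (b x : 'rV[R]_n) (c d t : R) (p q : spacetime).

Definition quadratic a b c d q : R :=
  \sum_(i < n) \sum_(j < n) a i j * q.1 ord0 i * q.1 ord0 j
  + \sum_(i < n) b ord0 i * q.1 ord0 i + c * q.2 + d.

Lemma continuous_quadratic a b c d : continuous (quadratic a b c d).
Proof.
have coordC i : continuous (fun q : spacetime => q.1 ord0 i).
  move=> q; apply: (@continuous_comp _ _ _ fst (fun y : 'rV[R]_n => y ord0 i)).
    exact: cvg_fst.
  exact: coord_continuous.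
move=> q; apply: cvgD; last exact: cvg_cst.
apply: cvgD; last by apply: cvgM; [exact: cvg_cst|exact: cvg_snd].
apply: cvgD.
  apply: continuous_big => [|i _]; first exact: add_continuous.
  apply: continuous_big => [|j _ {}q]; first exact: add_continuous.
  by apply: cvgM; [apply: cvgM; [exact: cvg_cst|exact: coordC]|exact: coordC].
apply: continuous_big => [|i _ {}q]; first exact: add_continuous.
by apply: cvgM; [exact: cvg_cst|exact: coordC].
Qed.

Lemma quadratic_time a b c d x s t :
  quadratic a b c d (x, s) - quadratic a b c d (x, t) = c * (s - t).
Proof. by rewrite /quadratic/=; ring. Qed.

(** Barriers stay within the polynomials allowed for test functions. The time coefficient is kept
    explicit because the left time derivative reads it off; the others only have to exist. *)
Lemma quadraticD_sqr a b c d (A c' e : R) x : exists a' b' d', forall q,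
  quadratic a b c d q + A * enorm (q.1 - x) ^+ 2 + c' * q.2 + e =
  quadratic a' b' (c + c') d' q.
Proof.
exists (a + A%:M), (\row_i (b ord0 i - 2 * A * x ord0 i)),
  (d + A * enorm x ^+ 2 + e) => q.
rewrite /quadratic !enorm_sqr.
have -> : \sum_(i < n) \sum_(j < n) (a + A%:M) i j * q.1 ord0 i * q.1 ord0 j =
    \sum_(i < n) \sum_(j < n) a i j * q.1 ord0 i * q.1 ord0 j
    + A * \sum_(i < n) q.1 ord0 i ^+ 2.
  rewrite mulr_sumr -big_split/=; apply: eq_bigr => i _.
  have -> : A * q.1 ord0 i ^+ 2 =
      \sum_(j < n) (A *+ (i == j)) * q.1 ord0 i * q.1 ord0 j.
    rewrite (bigD1 i)//= eqxx mulr1n big1 ?addr0 ?mulrA ?expr2 ?mulrA//.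
    by move=> j /negbTE; rewrite eq_sym => ->; rewrite mulr0n !mul0r.
  rewrite -big_split/=; apply: eq_bigr => j _.
  by rewrite !mxE; ring.
have -> : \sum_(i < n) (\row_i (b ord0 i - 2 * A * x ord0 i)) ord0 i * q.1 ord0 i =
    \sum_(i < n) b ord0 i * q.1 ord0 i
    - 2 * A * \sum_(i < n) x ord0 i * q.1 ord0 i.
  rewrite mulr_sumr -sumrB; apply: eq_bigr => i _; rewrite mxE; ring.
have -> : \sum_(i < n) (q.1 - x) ord0 i ^+ 2 = \sum_(i < n) q.1 ord0 i ^+ 2
    - 2 * (\sum_(i < n) x ord0 i * q.1 ord0 i) + \sum_(i < n) x ord0 i ^+ 2.
  rewrite mulr_sumr -sumrB -big_split/=; apply: eq_bigr => i _.
  by rewrite !mxE; ring.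
ring.
Qed.

Lemma quadratic_bounded a b c d t (r : R) : 0 <= r -> exists M, forall q,
  (forall i, `|q.1 ord0 i| <= r) -> q.2 = t -> `|quadratic a b c d q| <= M.
Proof.
move=> r0; exists (\sum_(i < n) \sum_(j < n) `|a i j| * r * r
  + \sum_(i < n) `|b ord0 i| * r + `|c * t| + `|d|) => q qr qt.
rewrite /quadratic qt; apply: (le_trans (ler_normD _ _)); rewrite lerD2r.
apply: (le_trans (ler_normD _ _)); rewrite lerD2r.
apply: (le_trans (ler_normD _ _)); apply: lerD.
  apply: (le_trans (ler_norm_sum _ _ _)); apply: ler_sum => i _.
  apply: (le_trans (ler_norm_sum _ _ _)); apply: ler_sum => j _.
  by rewrite !normrM; do !apply: ler_pM; rewrite ?mulr_ge0.
apply: (le_trans (ler_norm_sum _ _ _)); apply: ler_sum => i _.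
by rewrite normrM; apply: ler_pM.
Qed.

End quadratics.

(** * Measurability of norms and polynomials along [vec] *)

Section tuple_vectors.
Context {R : realType} {n : nat}.
Local Notation M := (measurableTypeR R).
Implicit Types (t : n.-tuple M) (y : 'rV[R]_n).

Lemma measurable_coord_vec (i : 'I_n) :
  measurable_fun setT (fun t => vec t ord0 i : R).
Proof.
rewrite (_ : (fun _ => _) = (fun t => tnth t i)); first exact: measurable_tnth.
by apply/funext => t; rewrite mxE.
Qed.

Lemma measurable_sqrtr : measurable_fun [set: R] Num.sqrt.
Proof. by apply: continuous_measurable_fun; exact: sqrt_continuous. Qed.

Lemma measurable_enorm_vec y :
  measurable_fun setT (fun t => enorm (vec t - y)).
Proof.
apply: measurableT_comp; first exact: measurable_sqrtr.
apply: measurable_sum => i.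
rewrite (_ : (fun _ => _) = (fun t => (vec t ord0 i - y ord0 i) ^+ 2)).
  apply: measurable_funX; apply: measurable_funB => //.
  exact: measurable_coord_vec.
by apply/funext => t; rewrite !mxE.
Qed.

Lemma measurable_quadratic_vec a b c d s :
  measurable_fun setT (fun t => quadratic a b c d (vec t, s)).
Proof.
have mc := measurable_coord_vec.
apply: measurable_funD => //; apply: measurable_funD; first apply: measurable_funD.
- apply: measurable_sum => i; apply: measurable_sum => j.
  by apply: measurable_funM => //; apply: measurable_funM.
- by apply: measurable_sum => i; apply: measurable_funM.
- by apply: (eq_measurable_fun (cst (c * s))).
Qed.

End tuple_vectors.

(** * Weighted spaces *)

Section weighted_spaces.
Context {R : realType} {n : nat}.
Variable sigma : R.
Local Notation M := (measurableTypeR R).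
Local Notation mu := (lebesgue_tuple R n).
Local Notation omega := (@omega R n sigma).
Implicit Types (g : 'rV[R]_n -> R) (y : 'rV[R]_n) (u : 'rV[R]_n * R -> R).

Lemma omega_gt0 y : 0 < omega y.
Proof. by rewrite invr_gt0 ltr_wpDr ?powR_ge0. Qed.

Lemma omega_ge0 y : 0 <= omega y. Proof. exact/ltW/omega_gt0. Qed.

Lemma omega_le1 y : omega y <= 1.
Proof. by rewrite invf_le1 ?ltr_wpDr ?powR_ge0// lerDl powR_ge0. Qed.

Lemma measurable_omega_vec : measurable_fun setT (fun t => omega (@vec R n t)).
Proof.
rewrite (_ : (fun _ => _) =
    (fun t => (1 + enorm (vec t - 0 : 'rV[R]_n) `^ (n%:R + sigma)) `^ (-1))).
  apply: (measurableT_comp (measurable_powR _)).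
  apply: measurable_funD => //; apply: (measurableT_comp (measurable_powR _)).
  exact: measurable_enorm_vec.
by apply/funext => t; rewrite subr0 powR_inv1// addr_ge0// powR_ge0.
Qed.

Lemma measurable_enorm_vec_lt y r :
  measurable_fun setT (fun t => enorm (@vec R n t - y) < r).
Proof. by apply: measurable_fun_ltr => //; exact: measurable_enorm_vec. Qed.

Lemma enorm_ball_cube y r t : enorm (vec t - y) < r -> cube n (enorm y + r) t.
Proof.
move=> tr i; have := ler_coord_enorm (vec t) i; rewrite mxE => /le_trans; apply.
by rewrite -{1}(subrK y (vec t)) addrC (le_trans (enormD _ _))// lerD2l ltW.
Qed.

Lemma L1omegaB g h : L1omega sigma g -> L1omega sigma h ->
  L1omega sigma (fun y => g y - h y).
Proof.
move=> ig ih; rewrite /L1omega; under eq_fun do rewrite mulrBl EFinB.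
exact: integrableB.
Qed.

Lemma measurable_L1omega g : L1omega sigma g ->
  measurable_fun setT (fun t => g (@vec R n t) * omega (vec t)).
Proof. by move=> /measurable_int/measurable_EFinP. Qed.

Lemma measurable_abs_L1omega g : L1omega sigma g ->
  measurable_fun setT (fun t => `|g (@vec R n t)| * omega (vec t)).
Proof.
move=> /measurable_L1omega mg.
rewrite (_ : (fun _ => _) = Num.norm \o (fun t => g (@vec R n t) * omega (vec t))).
  exact: measurableT_comp.
by apply/funext => t /=; rewrite normrM (ger0_norm (omega_ge0 _)).
Qed.

(** Since [omega <= 1] and the polynomial is bounded on a cube containing the ball, the patched
    function is dominated by the old one plus a multiple of the indicator of the cube. *)
Lemma L1omega_patch a b c d y r s g : L1omega sigma g ->
  L1omega sigma (fun z => if enorm (z - y) < r then quadratic a b c d (z, s) else g z).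
Proof.
move=> ig; have [r0|r0] := ltP 0 r; last first.
  by under eq_fun do rewrite ltNge (le_trans r0 (enorm_ge0 _)).
have br0 : 0 <= enorm y + r by rewrite addr_ge0 ?enorm_ge0// ltW.
have [C qC] := quadratic_bounded a b c d s _ br0.
apply: (@le_integrable _ _ _ _ _ measurableT _
   (fun t => (`|g (vec t) * omega (vec t)|)%:E + (`|C| * \1_(cube n (enorm y + r)) t)%:E)%E).
- apply/measurable_EFinP.
  rewrite (_ : (fun _ => _) = (fun t => if enorm (vec t - y) < r
      then quadratic a b c d (vec t, s) * omega (vec t) else g (vec t) * omega (vec t))).
    apply: measurable_fun_ifT; first exact: measurable_enorm_vec_lt.
      apply: measurable_funM; first exact: measurable_quadratic_vec.
      exact: measurable_omega_vec.
    exact: measurable_L1omega.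
  by apply/funext => t /=; case: ifP.
- move=> t _; rewrite -EFinD /= lee_fin [leRHS]ger0_norm; last first.
    by rewrite addr_ge0// mulr_ge0// indicE.
  case: ifPn => [tr|_]; last by rewrite lerDl mulr_ge0// indicE.
  rewrite indicE mem_set ?mulr1; last exact: enorm_ball_cube _ _ _ tr.
  rewrite -[leLHS]add0r lerD// normrM (ger0_norm (omega_ge0 _)).
  rewrite (@le_trans _ _ (`|quadratic a b c d (vec t, s)|))//.
    by rewrite ler_piMr// omega_le1.
  rewrite (@le_trans _ _ C) ?ler_norm// qC//= => i.
  by have := enorm_ball_cube _ _ _ tr i; rewrite mxE.
- apply: integrableD => //; first exact: (integrable_abse ig).
  under eq_fun do rewrite EFinM.
  apply: integrableZl => //; apply/integrableP; split.
    by apply/measurable_EFinP; apply: measurable_indic; exact: measurable_cube.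
  under eq_integral do rewrite gee0_abs ?lee_fin//.
  rewrite integral_indic//; last exact: measurable_cube.
  by rewrite setIT; exact: lebesgue_tuple_cube_lty.
Qed.

Lemma L1omega_norm_ge0 g : (0 <= L1omega_norm sigma g)%E.
Proof.
by apply: integral_ge0 => t _; rewrite lee_fin mulr_ge0// omega_ge0.
Qed.

Lemma C_L1omega_sub al be al' be' u : al <= al' -> be' <= be ->
  C_L1omega sigma al be u -> C_L1omega sigma al' be' u.
Proof.
move=> al_le be_le [u1 u2]; split=> t /andP[t1 t2].
  by apply: u1; rewrite (le_lt_trans al_le t1) (le_trans t2).
by apply: u2; rewrite (le_lt_trans al_le t1) (le_trans t2).
Qed.

(** Inside the ball the time increment of the polynomial is [c * (t1 - t2)], independently of the
    space variable, so it contributes at most [|c * (t1 - t2)|] times the measure of an enclosing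
    cube. *)
Lemma C_L1omega_patch a b c d y r al be u : C_L1omega sigma al be u ->
  C_L1omega sigma al be
    (fun q => if enorm (q.1 - y) < r then quadratic a b c d q else u q).
Proof.
move=> [u1 u2]; split=> t2 t2ab /=; first exact: L1omega_patch (u1 _ t2ab).
have /andP[t2a t2b] := t2ab.
set Q := cube n (enorm y + r); pose m := fine (mu Q).
have muQ : mu Q = m%:E.
  by rewrite fineK// ge0_fin_numE//; exact: lebesgue_tuple_cube_lty.
apply: (@squeeze_cvge _ _ _ _ (cst 0%E) _ (fun t1 =>
  L1omega_norm sigma (fun z => (u (z, t1) - u (z, t2))%R) + (`|c * (t1 - t2)| * m)%R%:E)%E).
- near=> t1; rewrite L1omega_norm_ge0/=.
  have t1ab : al < t1 <= be.
    apply/andP; split; first by near: t1; exact: nbhs_left_gt.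
    by rewrite (le_trans _ t2b)// ltW//; near: t1; exact: nbhs_left_lt.
  rewrite EFinM -muQ.
  have -> : mu Q = (\int[mu]_t (\1_Q t)%:E)%E.
    by rewrite integral_indic// ?setIT//; exact: measurable_cube.
  rewrite -ge0_integralZl//; last first.
    by apply/measurable_EFinP; apply: measurable_indic; exact: measurable_cube.
  rewrite -ge0_integralD//; last 3 first.
  + by move=> t _; rewrite lee_fin mulr_ge0// omega_ge0.
  + apply/measurable_EFinP.
    exact: (measurable_abs_L1omega _ (L1omegaB _ _ (u1 _ t1ab) (u1 _ t2ab))).
  + under eq_fun do rewrite -EFinM.
    apply/measurable_EFinP; apply: measurable_funM => //.
    by apply: measurable_indic; exact: measurable_cube.
  apply: le_integralT => t.
    by rewrite lee_fin mulr_ge0// omega_ge0.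
  rewrite -EFinM -EFinD lee_fin; case: ifPn => tr; last first.
    by rewrite lerDl mulr_ge0.
  rewrite quadratic_time indicE mem_set ?mulr1; last exact: enorm_ball_cube _ _ _ tr.
  rewrite -[leLHS]add0r lerD// ?mulr_ge0 ?omega_ge0//.
  by rewrite ler_piMr// omega_le1.
- exact: cvg_cst.
- rewrite -[0%E]adde0; apply: cvgeD => //; first exact: u2.
  apply/cvg_EFin; first by near=> t1.
  rewrite [X in _ --> X](_ : _ = `|c * (t2 - t2)| * m); last first.
    by rewrite subrr mulr0 normr0 mul0r.
  apply: cvgMl; apply: cvg_norm; apply: cvgMr; apply: cvgB; last exact: cvg_cst.
  by apply: cvg_at_left_filter; exact: cvg_id.
Unshelve. all: by end_near. Qed.

End weighted_spaces.

(** * Kernels and extremal operators *)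

Section kernel_bounds.
Context {R : realType} {n : nat}.
Variables sigma Lambda : R.
Hypotheses (sigma_range : 0 < sigma < 2) (Lambda_ge1 : 1 <= Lambda).
Local Notation mu := (lebesgue_tuple R n).
Local Notation omega := (@omega R n sigma).
Implicit Types (x y z : 'rV[R]_n) (u v w h : 'rV[R]_n * R -> R).

Definition kappa z : R :=
  (2 - sigma) * Lambda * enorm z `^ (- (n%:R + sigma)).

(** The size of the second difference of a bump of radius [r]; its integral against the envelope
    [kappa] is the truncated second moment. *)
Definition trunc_sqr (r : R) z : R := Num.min (enorm z ^+ 2) (r ^+ 2).

Let coef_gt0 : 0 < (2 - sigma) * Lambda.
Proof.
have /andP[_ s2] := sigma_range.
by rewrite mulr_gt0 ?subr_gt0// (lt_le_trans ltr01).
Qed.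

Let order_ge0 : 0 <= n%:R + sigma :> R.
Proof. by have /andP[s0 _] := sigma_range; rewrite addr_ge0// ltW. Qed.

Lemma kappa_ge0 z : 0 <= kappa z.
Proof. by rewrite mulr_ge0 ?powR_ge0// ltW. Qed.

Lemma trunc_sqr_ge0 r z : 0 <= trunc_sqr r z.
Proof. by rewrite le_min !sqr_ge0. Qed.

Lemma measurable_enorm_vec0 :
  measurable_fun setT (fun t => enorm (@vec R n t)).
Proof.
by under eq_fun do rewrite -[vec _]subr0; exact: measurable_enorm_vec.
Qed.

Lemma measurable_kappa_vec : measurable_fun setT (fun t => kappa (vec t)).
Proof.
apply: measurable_funM => //.
exact: (measurableT_comp (measurable_powR _) measurable_enorm_vec0).
Qed.

Lemma measurable_trunc_sqr_vec r :
  measurable_fun setT (fun t => trunc_sqr r (@vec R n t)).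
Proof.
apply: measurable_minr => //; apply: measurable_funX.
exact: measurable_enorm_vec0.
Qed.

Lemma kernel_class_ge0 K : kernel_class sigma Lambda K ->
  forall z, z != 0 -> 0 <= K z.
Proof.
move=> [_ _ hK] z z0; have /andP[+ _] := hK z z0; apply: le_trans.
have /andP[_ s2] := sigma_range.
rewrite mulr_ge0 ?powR_ge0// mulr_ge0 ?invr_ge0 ?subr_ge0 ?ltW//.
exact: lt_le_trans Lambda_ge1.
Qed.

(** The two bounds on admissible kernels differ by the factor [Lambda ^+ 2], so a single kernel
    controls the envelope of all of them. *)
Lemma kernel_class_le K : kernel_class sigma Lambda K ->
  forall z, z != 0 -> K z <= kappa z <= Lambda ^+ 2 * K z.
Proof.
move=> [_ _ hK] z z0; have /andP[lK ->] := hK z z0; rewrite andTb.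
have L0 : 0 < Lambda by exact: lt_le_trans Lambda_ge1.
apply: le_trans (ler_wpM2l (sqr_ge0 Lambda) lK).
rewrite /kappa le_eqVlt; apply/orP; left; apply/eqP.
by field; rewrite gt_eqF.
Qed.

(** The bump is [r ^+ 2] at the centre, and takes the same value [r ^+ 2 - trunc_sqr r z] at [x + z]
    and [x - z]. *)
Lemma delta_ball_bump (g : 'rV[R]_n * R -> R) x t r z : 0 < r ->
  (forall y, g (y, t) =
     if enorm (y - x) < r then r ^+ 2 - enorm (y - x) ^+ 2 else 0) ->
  delta g (x, t) z = - (2 * trunc_sqr r z).
Proof.
move=> r0 gE; rewrite /delta !gE/= subrr (addrC x z) addrK (addrC x (- z)) addrK.
rewrite enormN enorm0 r0 expr0n/= subr0 /trunc_sqr minEle ler_pXn2r ?nnegrE ?enorm_ge0 ?(ltW r0)//.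
case: ltgtP => zr; rewrite ?zr; ring.
Qed.

(** The bump [g] is a difference of two test functions, so [Mplus] of it dominates a real number.
    Hence some admissible kernel does not send it to [-oo], which means that its truncated moment is
    finite; [kernel_class_le] carries this over to [kappa]. *)
Lemma trunc_sqr_kappa_lty (Omega : set 'rV[R]_n) (T : R) (I : operator)
    v x r t tau :
  elliptic sigma Lambda Omega T I -> test_pair sigma Omega T v x r t tau ->
  (\int[mu]_z (trunc_sqr r (vec z) * kappa (vec z))%:E < +oo)%E.
Proof.
move=> Iell tv; have [r0 tau0 sub vC [a [b [c [d vE]]]]] := tv.
have [a' [b' [d' E]]] := quadraticD_sqr a b c d (-1) 0 (r ^+ 2) x.
rewrite addr0 in E.
pose w (q : 'rV[R]_n * R) :=
  if enorm (q.1 - x) < r then quadratic a' b' c d' q else v q.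
have tw : test_pair sigma Omega T w x r t tau.
  split=> //; first exact: C_L1omega_patch.
  by exists a', b', c, d' => q [qr _]; rewrite /w qr.
have px : pcyl x r t tau (x, t).
  by split; rewrite /= ?subrr ?enorm0// lexx andbT gtrBl.
have [] := andP (Iell w v (x, t) _ _).
- by exists x, r, t, tau.
- by exists x, r, t, tau.
move=> _; set g := (w \- v)%R => Mp.
have gE y : g (y, t) =
    if enorm (y - x) < r then r ^+ 2 - enorm (y - x) ^+ 2 else 0.
  rewrite /g /w /=; case: ifPn => yr; last by rewrite subrr.
  rewrite vE; last by split; rewrite //= lexx andbT gtrBl.
  by rewrite -E/= mul0r/quadratic/=; ring.
have [L [[K KK <-] LK]] : exists L, L0 sigma Lambda L /\ (-oo < L g (x, t))%E.
  apply: contrapT => /forallNP h.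
  suff : (Mplus sigma Lambda g (x, t) <= -oo)%E.
    by move/(le_trans Mp); rewrite leeNy_eq.
  apply: ge_ereal_sup => _ [L LL <-]; rewrite leNgt; apply/negP => ?.
  by apply: (h L).
have K0 := kernel_class_ge0 _ KK.
have tK0 z : 0 <= 2 * trunc_sqr r z * K z.
  have [->|z0] := eqVneq z 0.
    by rewrite /trunc_sqr enorm0 expr0n/= min_l ?sqr_ge0// mulr0 mul0r.
  by rewrite mulr_ge0 ?K0// mulr_ge0 ?trunc_sqr_ge0.
have mtK : measurable_fun setT (fun t => 2 * trunc_sqr r (vec t) * K (vec t)).
  apply: measurable_funM; last by case: KK.
  by apply: measurable_funM => //; exact: measurable_trunc_sqr_vec.
have {LK} fin : (\int[mu]_z (2 * trunc_sqr r (vec z) * K (vec z))%:E < +oo)%E.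
  move: LK; rewrite /integral_operator.
  under eq_integral do rewrite (delta_ball_bump _ _ _ _ _ r0 gE) mulNr EFinN.
  rewrite integral_ge0N => [|z _]; last by rewrite lee_fin.
  by rewrite lteNr.
apply: (@le_lt_trans _ _ (\int[mu]_z
   ((Lambda ^+ 2)%:E * (2 * trunc_sqr r (vec z) * K (vec z))%:E))%E).
  apply: le_integralT => z; first by rewrite lee_fin mulr_ge0 ?trunc_sqr_ge0 ?kappa_ge0.
  rewrite -EFinM lee_fin; have [->|z0] := eqVneq (vec z) 0.
    by rewrite /trunc_sqr enorm0 expr0n/= min_l ?sqr_ge0// mulr0 !mul0r mulr0.
  have /andP[_ h] := kernel_class_le _ KK _ z0.
  apply: le_trans (ler_wpM2l (trunc_sqr_ge0 r (vec z)) h) _.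
  rewrite mulrCA ler_wpM2l ?sqr_ge0// -mulrA mulr_natl mulr2n lerDl.
  by rewrite mulr_ge0 ?trunc_sqr_ge0 ?K0.
rewrite ge0_integralZl//.
- by rewrite lte_mul_pinfty ?lee_fin ?sqr_ge0.
- exact/measurable_EFinP.
- by move=> z _; rewrite lee_fin.
- by rewrite lee_fin sqr_ge0.
Qed.

(** The integral is that of the positive part minus that of the negative part. For every admissible
    kernel the negative part is at most [g] times [kappa], whatever the size of the positive
    part. *)
Lemma le_Mminus h p (g : 'rV[R]_n -> R) (E : R) :
  (forall z, 0 <= g z) -> (forall z, - g z <= delta h p z) ->
  (\int[mu]_z (g (vec z) * kappa (vec z))%:E <= E%:E)%E ->
  ((- E)%:E <= Mminus sigma Lambda h p)%E.
Proof.
case: p => y s g0 gh gE; apply: le_ereal_inf_tmp => _ [_ [K KK <-] <-].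
rewrite /integral_operator integralE EFinN -[leLHS]add0e; apply: leeB.
  by apply: integral_ge0.
apply: le_trans gE; apply: le_integralT => z //.
rewrite funenegE -EFinN -EFin_max lee_fin ge_max mulr_ge0 ?kappa_ge0 ?g0// andbT.
(* Kernels are uncontrolled at the origin, but [delta] vanishes there. *)
have [->|z0] := eqVneq (vec z) 0.
  by rewrite /delta/= addr0 subr0 -mulr2n mulr_natl subrr mul0r oppr0 mulr_ge0 ?g0 ?kappa_ge0.
have /andP[Kk _] := kernel_class_le _ KK _ z0.
have := kernel_class_ge0 _ KK _ z0; have := gh (vec z); have := g0 (vec z).
by nra.
Qed.

(** Ratio of [kappa] to a translate of [omega] at distance at least [rho] from the origin, where [Y]
    bounds the translation. *)
Definition tail_coef (Y rho : R) : R :=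
  (2 - sigma) * Lambda *
  (rho `^ (- (n%:R + sigma)) + (Y / rho + 1) `^ (n%:R + sigma)).

Lemma tail_coef_ge0 Y rho : 0 <= tail_coef Y rho.
Proof. by rewrite mulr_ge0 ?addr_ge0 ?powR_ge0// ltW. Qed.

Lemma le_tail_coef (Y Y' rho : R) : 0 < rho -> 0 <= Y -> Y <= Y' ->
  tail_coef Y rho <= tail_coef Y' rho.
Proof.
move=> rho0 Y0 YY'; rewrite ler_pM2l// lerD2l ge0_ler_powR// ?nnegrE.
- by rewrite addr_ge0// divr_ge0// ltW.
- by rewrite addr_ge0// divr_ge0 ?(le_trans Y0 YY')// ltW.
- by rewrite lerD2r ler_pM2r ?invr_gt0.
Qed.

(** After multiplication by the denominator of [omega w], its term 1 is absorbed because |z| >= rho,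
    and its power of |w| because |w| <= (Y / rho + 1) |z|. These are the two summands of
    [tail_coef]. *)
Lemma kappa_le_omega (Y rho : R) z (w : 'rV[R]_n) : 0 < rho -> rho <= enorm z -> 0 <= Y ->
  enorm w <= Y + enorm z -> kappa z <= tail_coef Y rho * omega w.
Proof.
move=> rho0 rz Y0 wz; rewrite ler_pdivlMr ?ltr_wpDr ?powR_ge0//.
have z0 : 0 < enorm z by exact: lt_le_trans rz.
rewrite -mulrA ler_pM2l// mulrDr mulr1 lerD//.
  rewrite !powRN lef_pV2 ?posrE ?powR_gt0//.
  by rewrite ge0_ler_powR ?nnegrE ?(ltW rho0) ?(ltW z0).
rewrite powRN ler_pdivrMl ?powR_gt0// -powRM ?(ltW z0)//; last first.
  by rewrite addr_ge0// divr_ge0// ltW.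
rewrite ge0_ler_powR ?nnegrE ?enorm_ge0//.
  by rewrite mulr_ge0 ?enorm_ge0// addr_ge0// divr_ge0// ltW.
rewrite (le_trans wz)// mulrDr mulr1 lerD2r mulrCA ler_peMr// ler_pdivlMr//.
by rewrite mul1r.
Qed.

Let abs_omega (g : 'rV[R]_n -> R) t : \bar R := (`|g (vec t)| * omega (@vec R n t))%:E.

Let measurable_abs_omega (g : 'rV[R]_n -> R) : L1omega sigma g -> measurable_fun setT (abs_omega g).
Proof. by move=> ig; apply/measurable_EFinP; exact: measurable_abs_L1omega. Qed.

Let abs_omega_ge0 (g : 'rV[R]_n -> R) t : (0 <= abs_omega g t)%E.
Proof. by rewrite lee_fin mulr_ge0// omega_ge0. Qed.

Let abs_omega_translate (g : 'rV[R]_n -> R) y :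
  (fun t => (`|g (y + vec t)| * omega (y + vec t))%:E) =
  abs_omega g \o tuple_apply (fun i s => y ord0 i + s).
Proof.
apply/funext => t /=; congr ((`|g _| * omega _)%:E);
  by apply/rowP => i; rewrite !mxE tnth_mktuple.
Qed.

Let abs_omega_reflect (g : 'rV[R]_n -> R) y :
  (fun t => (`|g (y - vec t)| * omega (y - vec t))%:E) =
  abs_omega g \o tuple_apply (fun i s => y ord0 i - s).
Proof.
apply/funext => t /=; congr ((`|g _| * omega _)%:E);
  by apply/rowP => i; rewrite !mxE tnth_mktuple.
Qed.

Lemma measurable_translate_omega (g : 'rV[R]_n -> R) y : L1omega sigma g -> measurable_fun setT
  (fun t => (`|g (y + @vec R n t)| * omega (y + vec t))%:E).
Proof.
move=> /measurable_abs_omega mg; rewrite abs_omega_translate.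
apply: measurableT_comp => //; apply: measurable_tuple_apply => i.
by case: (preserves_lebesgueD (y ord0 i)).
Qed.

Lemma measurable_reflect_omega (g : 'rV[R]_n -> R) y : L1omega sigma g -> measurable_fun setT
  (fun t => (`|g (y - @vec R n t)| * omega (y - vec t))%:E).
Proof.
move=> /measurable_abs_omega mg; rewrite abs_omega_reflect.
apply: measurableT_comp => //; apply: measurable_tuple_apply => i.
by case: (preserves_lebesgueB (y ord0 i)).
Qed.

Lemma integral_translate_omega (g : 'rV[R]_n -> R) y : L1omega sigma g ->
  (\int[mu]_t (`|g (y + vec t)| * omega (y + vec t))%:E = L1omega_norm sigma g)%E.
Proof.
move=> ig; rewrite abs_omega_translate.
apply: (integral_tuple_apply n (fun i s => y ord0 i + s) (abs_omega g)) => [i||].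
- exact: preserves_lebesgueD.
- exact: measurable_abs_omega.
- exact: abs_omega_ge0.
Qed.

Lemma integral_reflect_omega (g : 'rV[R]_n -> R) y : L1omega sigma g ->
  (\int[mu]_t (`|g (y - vec t)| * omega (y - vec t))%:E = L1omega_norm sigma g)%E.
Proof.
move=> ig; rewrite abs_omega_reflect.
apply: (integral_tuple_apply n (fun i s => y ord0 i - s) (abs_omega g)) => [i||].
- exact: preserves_lebesgueB.
- exact: measurable_abs_omega.
- exact: abs_omega_ge0.
Qed.

(** Beyond [rho] the envelope is dominated by the weights [omega (y + z)] and [omega (y - z)]. By
    invariance under translation and reflection, each of the two far terms then costs one weighted
    norm of [g], whence the factor 2. *)
Lemma integral_kernel_bound (g : 'rV[R]_n -> R) y r rho (al J N : R) :
  0 < rho -> 0 <= al -> L1omega sigma g ->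
  (\int[mu]_t (trunc_sqr r (vec t) * kappa (vec t))%:E <= J%:E)%E ->
  (L1omega_norm sigma g <= N%:E)%E ->
  (\int[mu]_t ((al * trunc_sqr r (vec t) + (if rho <= enorm (vec t) then
       `|g (y + vec t)| + `|g (y - vec t)| else 0)) * kappa (vec t))%:E <=
   (al * J + 2 * (tail_coef (enorm y) rho * N))%:E)%E.
Proof.
move=> rho0 al0 ig hJ hN; set C := tail_coef (enorm y) rho.
have C0 : 0 <= C by exact: tail_coef_ge0.
have mtk : measurable_fun setT
    (fun t => (trunc_sqr r (@vec R n t) * kappa (vec t))%:E).
  apply/measurable_EFinP; apply: measurable_funM.
    exact: measurable_trunc_sqr_vec.
  exact: measurable_kappa_vec.
have tk0 t : (0 <= (trunc_sqr r (@vec R n t) * kappa (vec t))%:E)%E.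
  by rewrite lee_fin mulr_ge0 ?trunc_sqr_ge0 ?kappa_ge0.
have eo0 z : (0 <= (`|g z| * omega z)%:E)%E.
  by rewrite lee_fin mulr_ge0// omega_ge0.
have mp := measurable_translate_omega g y ig.
have mm := measurable_reflect_omega g y ig.
apply: (@le_trans _ _ (\int[mu]_t (al%:E * (trunc_sqr r (vec t) * kappa (vec t))%:E
   + (C%:E * (`|g (y + vec t)| * omega (y + vec t))%:E
      + C%:E * (`|g (y - vec t)| * omega (y - vec t))%:E)))%E).
  apply: le_integralT => t.
    rewrite lee_fin mulr_ge0 ?kappa_ge0// addr_ge0//.
      by rewrite mulr_ge0 ?trunc_sqr_ge0.
    by case: ifP => // _; rewrite addr_ge0.
  apply: (@le_trans _ _ (al * (trunc_sqr r (vec t) * kappa (vec t))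
      + (C * (`|g (y + vec t)| * omega (y + vec t))
         + C * (`|g (y - vec t)| * omega (y - vec t))))%:E); last first.
    by rewrite 2!EFinD 3!EFinM.
  rewrite lee_fin mulrDl -mulrA lerD2l.
  case: ifPn => rt; last first.
    by rewrite mul0r; apply: addr_ge0; rewrite mulr_ge0// mulr_ge0// omega_ge0.
  rewrite mulrDl lerD// (mulrCA C) ler_wpM2l//; apply: kappa_le_omega => //.
  - exact: enorm_ge0.
  - exact: enormD.
  - exact: enorm_ge0.
  - exact: enormB.
have mZ (h : n.-tuple (measurableTypeR R) -> \bar R) (k : R) :
    measurable_fun setT h -> measurable_fun setT (fun t => k%:E * h t)%E.
  by move=> mh; apply: emeasurable_funM.
have C0e : (0 <= C%:E)%E by rewrite lee_fin.
have al0e : (0 <= al%:E)%E by rewrite lee_fin.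
have Ce0 z : (0 <= C%:E * (`|g z| * omega z)%:E)%E by exact: mule_ge0.
rewrite (ge0_integralD mu measurableT (f1 := fun t => _ * _)%E); first last.
- by apply: emeasurable_funD; exact: mZ.
- by move=> t _; apply: adde_ge0; exact: Ce0.
- exact: mZ.
- by move=> t _; exact: mule_ge0.
rewrite (ge0_integralD mu measurableT (f1 := fun t => _ * _)%E); first last.
- exact: mZ.
- by move=> t _; exact: Ce0.
- exact: mZ.
- by move=> t _; exact: Ce0.
rewrite mulr_natl mulr2n; apply: (@le_trans _ _
  (al%:E * J%:E + (C%:E * N%:E + C%:E * N%:E))%E); last by rewrite 2!EFinD 2!EFinM.
apply: leeD; last apply: leeD.
- by rewrite (ge0_integralZl mu measurableT mtk)//; exact: lee_wpmul2l.
- rewrite (ge0_integralZl mu measurableT mp)// (integral_translate_omega _ _ ig).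
  exact: lee_wpmul2l.
- rewrite (ge0_integralZl mu measurableT mm)// (integral_reflect_omega _ _ ig).
  exact: lee_wpmul2l.
Qed.

End kernel_bounds.

(** * Touching points *)

Section touching.
Context {R : realType} {n : nat}.
Variables (sigma Lambda T : R) (Omega : set 'rV[R]_n).
Hypotheses (sigma_range : 0 < sigma < 2) (Lambda_ge1 : 1 <= Lambda).
Local Notation spacetime := ('rV[R]_n * R)%type.
Local Notation mu := (lebesgue_tuple R n).
Implicit Types (x y z : 'rV[R]_n) (p q : spacetime).

Lemma pcyl_center x (r t tau : R) : 0 < r -> 0 < tau -> pcyl x r t tau (x, t).
Proof. by move=> r0 tau0; split; rewrite /= ?subrr ?enorm0// lexx andbT gtrBl. Qed.

Lemma left_time_derivative_quadratic w a b c d y (s rho kap : R) :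
  0 < rho -> 0 < kap ->
  (forall q, pcyl y rho s kap q -> w q = quadratic a b c d q) ->
  left_time_derivative w (y, s) = c.
Proof.
move=> rho0 kap0 wE; apply: lim_near_cst => //.
near=> h.
have h0 : 0 < h by near: h; exact: nbhs_right_gt.
rewrite /= !wE.
- by rewrite quadratic_time opprB addrC subrK mulfK ?gt_eqF.
- split; rewrite /= ?subrr ?enorm0// gerBl (ltW h0) andbT ltrD2l ltrN2.
  by near: h; exact: nbhs_right_lt.
- exact: pcyl_center.
Unshelve. all: by end_near. Qed.

(** Both the cylinder and [pdom] omit their bottom time, so equality is possible; a lower bottom
    would put [(y, - T)] in the cylinder. *)
Lemma pcyl_sub_time (y : 'rV[R]_n) (rho s kap : R) : 0 < rho -> 0 < kap ->
  pcyl y rho s kap `<=` pdom Omega T -> - T <= s - kap /\ s <= 0.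
Proof.
move=> rho0 kap0 sub; have [_] := sub _ (pcyl_center y rho s kap rho0 kap0).
rewrite /= in_itv/= => /andP[sT ->]; split=> //; rewrite leNgt; apply/negP => h.
have hT : pcyl y rho s kap (y, - T).
  by split; rewrite /= ?subrr ?enorm0// h ltW.
by have [_] := sub _ hT; rewrite /= in_itv/= ltxx.
Qed.

(** * The supersolution inequality at a contact point *)

Section touching_point.
Variables (I : @operator R n) (f u u' v : spacetime -> R).
Variables (x : 'rV[R]_n) (r t tau : R) (a : 'M[R]_n) (b : 'rV[R]_n) (c d : R).
Hypotheses (I_elliptic : elliptic sigma Lambda Omega T I)
  (u_super : viscosity_supersolution sigma Omega T I f u)
  (u_C : C_L1omega sigma (- T) 0 u) (u'_C : C_L1omega sigma (- T) 0 u')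
  (v_test : test_pair sigma Omega T v x r t tau)
  (vE : forall q, pcyl x r t tau q -> v q = quadratic a b c d q)
  (v_le : forall q, t - tau < q.2 <= t -> v q <= u' q).
Variable J : R.
Hypothesis J_bound :
  (\int[mu]_z (trunc_sqr r (vec z) * kappa sigma Lambda (vec z))%:E <= J%:E)%E.

(* The terms in [eps] make the contact strict. *)
Lemma viscosity_touch_eps (x0 y : 'rV[R]_n) (A c' s rho kap N eps : R) :
  0 <= A -> 0 < eps -> 0 < rho <= r -> 0 < kap ->
  pcyl y rho s kap `<=` pcyl x r t tau ->
  (forall q, pcyl y rho s kap q ->
    u (y, s) - (v (y, s) + c' * s - A * enorm (y - x0) ^+ 2) <=
    u q - (v q + c' * q.2 - A * enorm (q.1 - x0) ^+ 2)) ->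
  (L1omega_norm sigma (fun z => u (z, s) - u' (z, s))%R <= N%:E)%E ->
  f (y, s) <= c + c' + eps - I v (y, s)
    + ((2 * (A + eps) + 2 * `|u (y, s) - v (y, s)| / rho ^+ 2) * J
       + 2 * (@tail_coef R n sigma Lambda (enorm y) rho * N)).
Proof.
move=> A0 eps0 /andP[rho0 rhor] kap0 sub umin uN.
have [r0 tau0 subdom _ _] := v_test.
have pys : pcyl y rho s kap (y, s) by exact: pcyl_center.
have [sT s0] : - T <= s - kap /\ s <= 0.
  by apply: (pcyl_sub_time y rho) => // q /sub/subdom.
have sT' : - T < s <= 0 by rewrite s0 andbT (le_lt_trans sT)// gtrBl.
set h0 := u (y, s) - v (y, s).
(* This constant makes [w] agree with [u] at [(y, s)]. *)
pose e := u (y, s) - (v (y, s) + c' * s - A * enorm (y - x0) ^+ 2) - eps * s.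
have [a1 [b1 [d1 E1]]] := quadraticD_sqr a b c d (- A) c' 0 x0.
have [a2 [b2 [d2 E2]]] := quadraticD_sqr a1 b1 (c + c') d1 (- eps) eps e y.
pose w q := if enorm (q.1 - y) < rho then quadratic a2 b2 (c + c' + eps) d2 q
            else u q.
have wE q : pcyl y rho s kap q -> w q = v q + c' * q.2
    - A * enorm (q.1 - x0) ^+ 2 - eps * enorm (q.1 - y) ^+ 2 + eps * q.2 + e.
  move=> qc; have [qrho _] := qc; rewrite /w qrho -E2 -E1 vE; last exact: sub.
  by ring.
have tw : test_pair sigma Omega T w y rho s kap.
  split=> //.
  - by move=> q /sub/subdom.
  - by apply: C_L1omega_patch; exact: C_L1omega_sub u_C.
  - by exists a2, b2, (c + c' + eps), d2 => q [qrho _]; rewrite /w qrho.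
have wys : w (y, s) = u (y, s).
  by rewrite wE//= subrr enorm0 /e; ring.
have : f (y, s) <= left_time_derivative w (y, s) - I w (y, s).
  apply: (u_super w y rho s kap tw wys).
  - move=> q qc qys; rewrite wE//.
    have [qrho /andP[qs1 qs2]] := qc.
    have := umin q qc; rewrite /e.
    suff : 0 < eps * enorm (q.1 - y) ^+ 2 + eps * (s - q.2) by lra.
    have [q1|q1] := eqVneq q.1 y.
      have q2 : q.2 < s.
        rewrite lt_neqAle qs2 andbT; apply: contraNneq qys => q2.
        by rewrite -q1 -q2 -surjective_pairing.
      by rewrite ltr_wpDl ?mulr_gt0 ?subr_gt0// mulr_ge0 ?sqr_ge0 ?ltW.
    rewrite ltr_pwDl//; first by rewrite mulr_gt0 ?exprn_gt0 ?enorm_gt0 ?subr_eq0.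
    by rewrite mulr_ge0 ?subr_ge0 ?(ltW eps0).
  - by move=> q qrho _; rewrite /w ltNge qrho.
have -> : left_time_derivative w (y, s) = c + c' + eps.
  apply: (left_time_derivative_quadratic w a2 b2 _ d2 y s rho kap) => //.
  by move=> q [qrho _]; rewrite /w qrho.
move=> fle.
have [] := andP (I_elliptic w v (y, s) _ _).
- by exists y, rho, s, kap.
- by exists x, r, t, tau; split=> //; exact: sub.
move=> Mm _.
(* The first term pays for the concave paraboloids near the contact point. The second pays for the
   contact value [h0] at distance at least [rho], where [trunc_sqr] is at least [rho ^+ 2]. *)
set al := 2 * (A + eps) + 2 * `|h0| / rho ^+ 2.
set C := tail_coef _ _ _ _.
suff : ((- (al * J + 2 * (C * N)))%:E <= Mminus sigma Lambda (w \- v)%R (y, s))%E.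
  by move=> /le_trans/(_ Mm); rewrite lee_fin; lra.
have al0 : 0 <= al.
  apply: addr_ge0; first by rewrite mulr_ge0// addr_ge0// ltW.
  by rewrite mulr_ge0 ?invr_ge0 ?sqr_ge0// mulr_ge0.
pose g z := u (z, s) - u' (z, s).
have gL1 : L1omega sigma g by apply: L1omegaB; [exact: u_C.1|exact: u'_C.1].
pose m z := al * trunc_sqr r z +
  (if rho <= enorm z then `|g (y + z)| + `|g (y - z)| else 0).
apply: (le_Mminus sigma Lambda sigma_range Lambda_ge1 _ _ m).
- move=> z; rewrite addr_ge0 ?mulr_ge0 ?trunc_sqr_ge0//.
  by case: ifP => // _; rewrite addr_ge0.
- move=> z; rewrite /m /delta/= wys -/h0.
  have tz : s - kap < s <= s by rewrite lexx andbT gtrBl.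
  have [zr|zr] := leP rho (enorm z).
    have tz' : t - tau < s <= t by have [] := sub _ pys.
    (* Outside the ball [w] is [u], and [v <= u'] bounds [w - v] below by [u - u']. *)
    have step z' : enorm z' = enorm z -> - `|g (y + z')| <= w (y + z', s) - v (y + z', s).
      move=> z'z; rewrite /w/= addrAC subrr add0r z'z ltNge zr/=.
      have := v_le (y + z', s) tz'; rewrite /g.
      have := ler_norm (- (u (y + z', s) - u' (y + z', s))); rewrite normrN; lra.
    have h1 := step z erefl; have h2 := step (- z) (enormN z).
    have tr : rho ^+ 2 <= trunc_sqr r z.
      by rewrite le_min !ler_pXn2r ?nnegrE ?enorm_ge0 ?(ltW rho0) ?(ltW r0) ?zr.
    have : 2 * `|h0| <= al * trunc_sqr r z.
      apply: (@le_trans _ _ (2 * `|h0| / rho ^+ 2 * trunc_sqr r z)).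
        rewrite -mulrA ler_peMr ?mulr_ge0// mulrC ler_pdivlMr ?mul1r//.
        by rewrite exprn_gt0.
      apply: ler_wpM2r; first exact: trunc_sqr_ge0.
      by rewrite lerDr mulr_ge0// addr_ge0// ltW.
    by have := ler_norm h0; lra.
  have pz z' : enorm z' = enorm z -> pcyl y rho s kap (y + z', s).
    by move=> z'z; split; rewrite //= addrAC subrr add0r z'z.
  rewrite !wE; [|by apply: pz; rewrite enormN|exact: pz]; rewrite /= addr0.
  (* By the parallelogram identity a squared distance has second difference 2 |z|^2, wherever it is
     centred. *)
  have par := congr1 ( *%R A) (enorm_parallelogram (y - x0) z).
  have -> : y + z - x0 = y - x0 + z by rewrite addrAC.
  have -> : y - z - x0 = y - x0 - z by rewrite addrAC.
  have -> : y + z - y = z by rewrite addrAC subrr add0r.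
  have -> : y - z - y = - z by rewrite addrAC subrr add0r.
  rewrite enormN.
  have -> : trunc_sqr r z = enorm z ^+ 2.
    apply: min_l; rewrite ler_pXn2r ?nnegrE ?enorm_ge0 ?(ltW r0)//.
    by rewrite ltW// (lt_le_trans zr).
  have k0 : 0 <= 2 * `|h0| / rho ^+ 2 * enorm z ^+ 2.
    apply: mulr_ge0; last exact: sqr_ge0.
    by rewrite mulr_ge0 ?invr_ge0 ?sqr_ge0// mulr_ge0.
  rewrite /al mulrDl.
  have hE : h0 = u (y, s) - v (y, s) by [].
  rewrite hE /e; lra.
- by apply: integral_kernel_bound.
Qed.

(** The limit of the previous estimate as [eps] tends to 0. In the applications [u] is one of the
    approximating functions and [u'] their limit, while [A] and [c'] are the steepness of a barrier
    in space and its slope in time. *)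
Lemma viscosity_touch (x0 y : 'rV[R]_n) (A c' s rho kap N : R) :
  0 <= A -> 0 < rho <= r -> 0 < kap ->
  pcyl y rho s kap `<=` pcyl x r t tau ->
  (forall q, pcyl y rho s kap q ->
    u (y, s) - (v (y, s) + c' * s - A * enorm (y - x0) ^+ 2) <=
    u q - (v q + c' * q.2 - A * enorm (q.1 - x0) ^+ 2)) ->
  (L1omega_norm sigma (fun z => u (z, s) - u' (z, s))%R <= N%:E)%E ->
  f (y, s) <= c + c' - I v (y, s)
    + ((2 * A + 2 * `|u (y, s) - v (y, s)| / rho ^+ 2) * J
       + 2 * (@tail_coef R n sigma Lambda (enorm y) rho * N)).
Proof.
move=> A0 rho0 kap0 sub umin uN; apply/ler_addgt0Pr => e e0.
have J0 : 0 <= J.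
  rewrite -lee_fin; apply: le_trans J_bound; apply: integral_ge0 => z _.
  by rewrite lee_fin mulr_ge0 ?trunc_sqr_ge0 ?kappa_ge0.
have J1 : 0 < 1 + 2 * J by rewrite ltr_pwDl// mulr_ge0.
(* A strictness parameter [eps] costs [eps * (1 + 2 * J)] in total. *)
have e'0 : 0 < e / (1 + 2 * J) by rewrite divr_gt0.
have := viscosity_touch_eps x0 y A c' s rho kap N _ A0 e'0 rho0 kap0 sub umin uN.
have eE : e = e / (1 + 2 * J) * (1 + 2 * J) by rewrite mulfVK// gt_eqF.
move/le_trans; apply; rewrite [in leRHS]eE.
set e' := e / _; nra.
Qed.

End touching_point.
End touching.

(** * Compactness and Gamma convergence *)

Section limits.
Context {R : realType} {n : nat}.
Local Notation spacetime := ('rV[R]_n * R)%type.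
Implicit Types (x y z : 'rV[R]_n) (p q : spacetime).

Definition closed_pcyl x (rho t1 t2 : R) : set spacetime :=
  [set q | enorm (q.1 - x) <= rho /\ t1 <= q.2 <= t2].

Lemma compact_closed_pcyl x (rho t1 t2 : R) : compact (closed_pcyl x rho t1 t2).
Proof.
have cball : compact [set y : 'rV[R]_n | enorm (y - x) <= rho].
  apply: (subclosed_compact _ (rV_compact (A := fun i =>
    `[x ord0 i - rho, x ord0 i + rho]%classic) _)).
  - have cf : continuous (fun y => enorm (y - x)).
      move=> y; apply: (@continuous_comp _ _ _ (fun y => y - x) (@enorm R n)).
        have h : id @ nbhs y --> y by exact: cvg_id.
        exact: (cvgB h (cvg_cst x)).
      exact: continuous_enorm.
    exact: (closed_comp (fun y _ => cf y) (@closed_le R rho)).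
  - by move=> i; exact: segment_compact.
  - move=> y yr i /=; rewrite in_itv/= -ler_distl.
    by have := ler_coord_enorm (y - x) i; rewrite !mxE => /le_trans; apply.
have := compact_setX cball (@segment_compact R t1 t2).
by congr compact; apply/seteqP; split => q /=; rewrite in_itv.
Qed.

(** If the infimum were not attained, every point would have a neighbourhood in [D] where [g]
    exceeds some level above the infimum; compactness provides one such level for all of [D], a
    contradiction. *)
Lemma lsc_min_attained (D : set spacetime) (g : spacetime -> R) (m : R) :
  compact D -> D !=set0 -> (forall q, D q -> m <= g q) ->
  (forall p, D p -> forall a, a < g p -> \forall q \near p, D q -> a < g q) ->
  exists2 z, D z & forall q, D q -> g z <= g q.
Proof.
move=> cD [q0 Dq0] gm glsc; apply: contrapT => nmin.
pose G := g @` D; have Ginf : has_inf G.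
  by split; [exists (g q0), q0|exists m => _ [q Dq <-]; exact: gm].
have infg q : D q -> inf G < g q.
  move=> Dq; have gq : inf G <= g q by apply: ge_inf; [exact: Ginf.2|exists q].
  rewrite lt_neqAle gq andbT; apply/eqP => e; apply: nmin.
  by exists q => // q' Dq'; rewrite -e; apply: ge_inf; [exact: Ginf.2|exists q'].
have /near_covering_withinP/(_ R (inf G)^'+ (fun a q => a < g q)) :=
  (compact_near_coveringP D).1 cD.
case.
- move=> p Dp; have gp := infg p Dp.
  set e := (inf G + g p) / 2.
  have e1 : inf G < e by rewrite /e; lra.
  have e2 : e < g p by rewrite /e; lra.
  exists ([set q | D q -> e < g q], [set a | a < e]) => /=.
    by split; [exact: glsc|exact: nbhs_right_lt].
  by move=> [q a] /= [h ae] Dq; exact: lt_trans ae (h Dq).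
- move=> e /= e0 he.
  have := he (inf G + e / 2); rewrite /ball/= opprD addrA subrr sub0r normrN.
  rewrite gtr0_norm ?divr_gt0// ltr_pdivrMr// ltr_pMr// ltr1n => /(_ isT).
  rewrite ltrDl divr_gt0// => /(_ isT) h.
  have : inf G + e / 2 <= inf G.
    by apply: lb_le_inf; [exact: Ginf.1|move=> _ [q Dq <-]; apply/ltW/h].
  by rewrite gerDl leNgt divr_gt0.
Qed.

Lemma uniform_cvg_near (A : set spacetime) (F_ : nat -> spacetime -> R) F (e : R) :
  0 < e -> {uniform A, F_ @ \oo --> F} ->
  \forall k \near \oo, forall q, A q -> `|F q - F_ k q| < e.
Proof.
move=> e0 /(_ [set G | forall q, A q -> `|F q - G q| < e]); apply.
apply/uniform_nbhs; exists [set ab : R * R | ball ab.1 e ab.2]; split.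
  exact: (entourage_ball _ (PosNum e0)).
by move=> G hG q Aq; have := hG q Aq.
Qed.

Variables (Omega : set 'rV[R]_n) (T : R) (u_ : nat -> spacetime -> R)
  (u : spacetime -> R).
Hypothesis u_Gamma : Gamma_cvg Omega T u_ u.

(* The sequences of [Gamma_cvg] run over all [k], while the negation of the
   claim only yields bad points along a subsequence [(bad N).1 >= N]; the value
   [p] is inserted at the remaining indices. *)
Lemma Gamma_liminf_left p (a : R) : pdom Omega T p -> a < u p ->
  exists2 e : R, 0 < e & \forall k \near \oo, forall q, pdom Omega T q ->
    enorm (q.1 - p.1) < e -> `|q.2 - p.2| < e -> q.2 <= p.2 -> a < u_ k q.
Proof.
move=> pO ap; apply: contrapT => nh.
have /choice[bad badP] : forall N : nat, exists kq : nat * spacetime,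
    [/\ (N <= kq.1)%N, pdom Omega T kq.2, enorm (kq.2.1 - p.1) < N.+1%:R^-1,
        `|kq.2.2 - p.2| < N.+1%:R^-1 & kq.2.2 <= p.2 /\ u_ kq.1 kq.2 <= a].
  move=> N; apply: contrapT => nN; apply: nh.
  exists N.+1%:R^-1; first by rewrite invr_gt0.
  exists N => // k /= Nk q qO q1 q2 q3; rewrite ltNge; apply/negP => qa.
  by apply: nN; exists (k, q).
have /choice[z zP] : forall k, exists q,
    (exists2 N, (bad N).1 = k & q = (bad N).2) \/
    ((forall N, (bad N).1 <> k) /\ q = p).
  move=> k; have [[N Nk]|nN] := pselect (exists N, (bad N).1 = k).
    by exists (bad N).2; left; exists N.
  by exists p; right; split=> // N Nk; apply: nN; exists N.
have zO k : pdom Omega T (z k).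
  by have [[N _ ->]|[_ ->]] := zP k => //; case: (badP N).
have zt k : (z k).2 <= p.2.
  by have [[N _ ->]|[_ ->]] := zP k => //; case: (badP N) => _ _ _ _ [].
have zp : z @ \oo --> p.
  move=> B /nbhs_enorm_ball[e e0 eB].
  have [m me] : exists m : nat, m.+1%:R^-1 < e.
    have [m _ hm] := near_infty_natSinv_lt (PosNum e0).
    by exists m; apply: hm => /=.
  (* Past the indices of the first [m] bad points, a bad point placed at index [k] has rank at least
     [m], hence lies within [e] of [p]. *)
  exists (\max_(i < m) (bad i).1).+1 => // k /= mk.
  have [[N Nk ->]|[_ ->]] := zP k; last first.
    by apply: eB; rewrite ?subrr ?enorm0 ?normr0.
  have mN : (m <= N)%N.
    rewrite leqNgt; apply/negP => Nm; move: mk; rewrite -Nk ltnNge => /negP; apply.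
    exact: (leq_bigmax (Ordinal Nm)).
  have Ne : N.+1%:R^-1 < e.
    by rewrite (le_lt_trans _ me)// lef_pV2 ?posrE// ler_nat.
  have [_ _ h1 h2 _] := badP N.
  by apply: eB; [exact: lt_trans Ne|exact: lt_trans Ne].
have := u_Gamma.1 z p zO pO zp zt; rewrite leNgt => /negP; apply.
apply: le_lt_trans (_ : (a%:E < (u p)%:E)%E); last by rewrite lte_fin.
rewrite -[limn_einf _]/(limf_einf _ _) limf_einfE.
(* Every eventual set contains the index of a bad point, so the infimum over it is at most [a]. *)
apply: ge_ereal_sup => _ [V [N _ NV] <-].
have [Nk _ _ _ _] := badP N.
apply: (@le_trans _ _ (u_ (bad N).1 (z (bad N).1))%:E).
  by apply: ereal_inf_lbound; exists (bad N).1 => //; exact: NV.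
have [[N' <- ->]|[/(_ N)]//] := zP (bad N).1.
by rewrite lee_fin; case: (badP N') => _ _ _ _ [].
Qed.

Lemma Gamma_recovery p : pdom Omega T p -> exists z : nat -> spacetime,
  [/\ forall k, pdom Omega T (z k), z @ \oo --> p, forall k, (z k).2 <= p.2 &
      forall a, u p < a -> \forall k \near \oo, u_ k (z k) < a].
Proof.
move=> pO; have [z [zO zp zt zu]] := u_Gamma.2 p pO.
exists z; split=> // a ua; move: zu; rewrite /limn_esup limf_esupE => zu.
have : (ereal_inf [set ereal_sup ((fun k => (u_ k (z k))%:E) @` V) | V in \oo] < a%:E)%E.
  by rewrite zu lte_fin.
move=> /ereal_inf_lt[_ [V Voo <-] Va].
apply: filterS Voo => k Vk; rewrite -lte_fin; apply: le_lt_trans Va.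
by apply: ereal_sup_ubound; exists k.
Qed.

End limits.

(** * Stability *)

Section stability.
Context {R : realType} {n : nat}.
Local Notation spacetime := ('rV[R]_n * R)%type.
Implicit Types (p q z : spacetime).
Variables (sigma Lambda T : R) (Omega : set 'rV[R]_n).
Hypotheses (sigma_range : 0 < sigma < 2) (Lambda_ge1 : 1 <= Lambda).
Variables (I_ : nat -> @operator R n) (I : @operator R n).
Variables (u_ : nat -> spacetime -> R) (u : spacetime -> R).
Variables (f_ : nat -> spacetime -> R) (f : spacetime -> R).
Hypotheses (I_elliptic : forall k, elliptic sigma Lambda Omega T (I_ k))
  (u_C_L1 : forall k, C_L1omega sigma (- T) 0 (u_ k))
  (u_lsc : forall k, lsc_on nbhs (pdom Omega T) (u_ k))
  (f_continuous : pcontinuous_on (pdom Omega T) f)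
  (u_super : forall k,
     viscosity_supersolution sigma Omega T (I_ k) (f_ k) (u_ k))
  (u_Gamma_cvg : Gamma_cvg Omega T u_ u)
  (ulim_C_L1 : C_L1omega sigma (- T) 0 u)
  (u_cvg_C_L1 : cvg_C_L1omega sigma (- T) 0 u_ u)
  (f_cvg : cvg_locally_uniformly Omega T f_ f)
  (I_cvg : weak_cvg sigma Omega T I_ I).
Variable C : R.
Hypothesis u_bounded : forall k p, pdom Omega T p -> `|u_ k p| <= C.

Lemma pcyl_sub (x : 'rV[R]_n) (r r' t tau tau' : R) : r' <= r -> tau' <= tau ->
  pcyl x r' t tau' `<=` pcyl x r t tau.
Proof.
move=> rr tt q [q1 /andP[q2 q3]]; split; first exact: lt_le_trans rr.
by rewrite q3 andbT (le_lt_trans _ q2)// lerD2l lerN2.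
Qed.

(** Compactness of the closed cylinder is Euclidean, so this rests on Euclidean lower semicontinuity
    of [u_ k]; the uniform bound [C] and the maximum of [psi] bound the difference below. *)
Lemma min_attained k (x0 : 'rV[R]_n) (rho t1 t2 : R) (psi : spacetime -> R) :
  closed_pcyl x0 rho t1 t2 `<=` pdom Omega T -> closed_pcyl x0 rho t1 t2 !=set0 ->
  continuous psi ->
  exists2 z, closed_pcyl x0 rho t1 t2 z &
    forall q, closed_pcyl x0 rho t1 t2 q -> u_ k z - psi z <= u_ k q - psi q.
Proof.
move=> sub D0 cpsi; have cD := compact_closed_pcyl x0 rho t1 t2.
have [m m0 psim] : exists2 m, 0 < m & forall q, closed_pcyl x0 rho t1 t2 q -> psi q <= m.
  have /compact_bounded/pinfty_ex_gt0[m m0 hm] :=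
    continuous_compact (continuous_subspaceT cpsi) cD.
  exists m => // q Dq; apply: le_trans (ler_norm _) (hm _ _).
  by exists q.
apply: (lsc_min_attained _ (fun q => u_ k q - psi q) (- C - m)) => //.
- move=> q Dq; have := u_bounded k _ (sub _ Dq); rewrite ler_norml => /andP[+ _].
  by have := psim q Dq; lra.
- move=> p Dp a ap.
  set d := (u_ k p - psi p - a) / 2.
  have d0 : 0 < d by rewrite /d; lra.
  have h1 : u_ k p - d < u_ k p by lra.
  have := u_lsc k p (sub _ Dp) _ h1.
  have : \forall q \near p, psi q < psi p + d.
    by apply: cvgr_lt (cpsi p) _ _; lra.
  apply: filterS2 => q q1 q2 Dq; have {}q2 := q2 (sub _ Dq).
  by move: q1 q2; rewrite /= /d; lra.
Qed.

Lemma L1omega_norm_near (delta : R) : 0 < delta ->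
  \forall k \near \oo, forall s, - T < s <= 0 ->
    (L1omega_norm sigma (fun y => u_ k (y, s) - u (y, s))%R <= delta%:E)%E.
Proof.
move=> delta0; have /fine_cvgP[fin cv] := u_cvg_C_L1.
have lt_delta := cvgr_lt _ cv _ delta0.
near=> k => s sT; apply: (@le_trans _ _ (ereal_sup
  [set L1omega_norm sigma (fun y => u_ k (y, t) - u (y, t))%R | t in `]-T, 0]%classic])).
  by apply: ereal_sup_ubound; exists s => //=; rewrite in_itv.
rewrite -[leLHS]fineK; last by near: k; exact: fin.
by rewrite lee_fin ltW//; near: k; exact: lt_delta.
Unshelve. all: by end_near. Qed.

Section test_function.
Variables (v : spacetime -> R) (x : 'rV[R]_n) (r t tau : R).
Variables (a : 'M[R]_n) (b : 'rV[R]_n) (c d : R).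
Hypotheses (v_test : test_pair sigma Omega T v x r t tau)
  (v_touch : v (x, t) = u (x, t))
  (v_lt : forall q, pcyl x r t tau q -> q != (x, t) -> v q < u q)
  (v_out : forall q, r <= enorm (q.1 - x) -> t - tau < q.2 <= t -> v q = u q)
  (vE : forall q, pcyl x r t tau q -> v q = quadratic a b c d q).

Let r0 : 0 < r. Proof. by case: v_test. Qed.
Let tau0 : 0 < tau. Proof. by case: v_test. Qed.
Let cyl_dom : pcyl x r t tau `<=` pdom Omega T. Proof. by case: v_test. Qed.
Let xt_cyl : pcyl x r t tau (x, t). Proof. exact: pcyl_center. Qed.

Lemma test_le q : t - tau < q.2 <= t -> v q <= u q.
Proof.
move=> qt; have [qr|qr] := leP r (enorm (q.1 - x)); first by rewrite v_out.
by have [->|qxt] := eqVneq q (x, t); [rewrite v_touch|apply/ltW/v_lt].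
Qed.

(** Near [(x, t)], [I v] varies little because one parabolically continuous [I_ m v] is uniformly
    close to it. Weak convergence is uniform on the half cylinder, whence the bounds on [eta]. *)
Lemma data_near (eps : R) : 0 < eps ->
  exists eta, [/\ 0 < eta, eta <= r / 2, eta <= tau / 2 &
    \forall k \near \oo, forall q, pcyl x eta t eta q ->
      f (x, t) - eps <= f_ k q /\ I v (x, t) - eps <= I_ k v q].
Proof.
(* Four comparisons lead from [I v (x, t)] to [I_ k v q]: through [I_ m v (x, t)], [I_ m v q] and
   [I v q]. *)
move=> eps0; have eps4 : 0 < eps / 4 by rewrite divr_gt0.
have [contI cvI] := I_cvg.
have hI := uniform_cvg_near _ _ _ _ eps4 (cvI _ _ _ _ _ v_test).
have r20 : 0 < r / 2 by rewrite divr_gt0.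
have tau20 : 0 < tau / 2 by rewrite divr_gt0.
have half_sub : pcyl x (r / 2) t (tau / 2) `<=` pcyl x r t tau.
  by apply: pcyl_sub; lra.
have [m _ /(_ m (leqnn m)) Im] := hI.
have [[e1 e2] /= [e10 e20] he] : pnbhs (x, t)
    [set q | pcyl x r t tau q -> `|I_ m v (x, t) - I_ m v q| < eps / 4].
  exact: (contI m v x r t tau v_test (x, t) xt_cyl _ (nbhsx_ballx _ _ eps4)).
have [[e3 e4] /= [e30 e40] he'] : pnbhs (x, t)
    [set q | pdom Omega T q -> `|f (x, t) - f q| < eps / 4].
  exact: (f_continuous (x, t) (cyl_dom _ xt_cyl) _ (nbhsx_ballx _ _ eps4)).
have hf : \forall k \near \oo, forall q,
    closed_pcyl x (r / 2) (t - tau / 2) t q -> `|f q - f_ k q| < eps / 4.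
  apply: (uniform_cvg_near _ _ _ _ eps4); apply: f_cvg.
    exact: compact_closed_pcyl.
  move=> q [q1 /andP[q2 q3]]; apply: cyl_dom; split; first by lra.
  by rewrite q3 andbT; lra.
set eta := Num.min (Num.min (Num.min e1 e2) (Num.min e3 e4))
                   (Num.min (r / 2) (tau / 2)).
have [h1 h2 h3 h4 [h5 h6]] : [/\ eta <= e1, eta <= e2, eta <= e3, eta <= e4 &
    eta <= r / 2 /\ eta <= tau / 2].
  by split; [..|split]; rewrite /eta !ge_min lexx ?orbT.
exists eta; split=> //; first by rewrite /eta !lt_min e10 e20 e30 e40 r20 tau20.
apply: filterS2 hI hf => k kI kf q qeta.
have q_half : pcyl x (r / 2) t (tau / 2) q by exact: pcyl_sub qeta.
have q_cyl := half_sub _ q_half.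
have c_half : pcyl x (r / 2) t (tau / 2) (x, t) by exact: pcyl_center.
have i1 := he _ (pcyl_sub _ _ _ _ _ _ h1 h2 _ qeta) q_cyl.
have i2 := he' _ (pcyl_sub _ _ _ _ _ _ h3 h4 _ qeta) (cyl_dom _ q_cyl).
have i3 := kI _ q_half.
have i4 := Im _ q_half.
have i5 := Im _ c_half.
have i6 : `|f q - f_ k q| < eps / 4.
  apply: kf; have [q1 /andP[q2 q3]] := q_half.
  by split; [exact: ltW|rewrite q3 andbT ltW].
move: i1 i2 i3 i4 i5 i6; rewrite !ltr_norml.
by do 6 move=> /andP[? ?]; split; lra.
Qed.

(** * Liminf inequality in both time directions, and the limit at contact points *)

Section near_touching_point.
Variables (eta eps : R).
Hypotheses (eta0 : 0 < eta) (eta_r : eta <= r) (eta_tau : eta <= tau).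
Hypothesis data : \forall k \near \oo, forall q, pcyl x eta t eta q ->
  f (x, t) - eps <= f_ k q /\ I v (x, t) - eps <= I_ k v q.
Variable J : R.
Hypothesis J_bound : (\int[lebesgue_tuple R n]_z
  (trunc_sqr r (vec z) * kappa sigma Lambda (vec z))%:E <= J%:E)%E.

Let eta_cyl : pcyl x eta t eta `<=` pcyl x r t tau.
Proof. exact: pcyl_sub. Qed.

Let J0 : 0 <= J.
Proof.
rewrite -lee_fin; apply: le_trans J_bound; apply: integral_ge0 => z _.
by rewrite lee_fin mulr_ge0 ?trunc_sqr_ge0 ?kappa_ge0.
Qed.

Lemma continuous_barrier (A c' e : R) (x0 : 'rV[R]_n) : continuous
  (fun q => quadratic a b c d q + A * enorm (q.1 - x0) ^+ 2 + c' * q.2 + e).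
Proof.
have [a' [b' [d' E]]] := quadraticD_sqr a b c d A c' e x0.
rewrite (_ : (fun _ => _) = quadratic a' b' (c + c') d').
  exact: continuous_quadratic.
by apply/funext => q; rewrite E.
Qed.

(* If [u_ k] fell below [al] shortly after [p.2], it would touch from above a
   barrier falling in time at a rate [c'] too fast for a supersolution. *)
Lemma Gamma_liminf_cyl p (al : R) : pcyl x eta t eta p -> al < u p ->
  exists2 e : R, 0 < e & \forall k \near \oo, forall q,
    enorm (q.1 - p.1) < e -> `|q.2 - p.2| < e -> q.2 <= t -> al < u_ k q.
Proof.
case: p => x0 t0 pe alp; have [/= p1 /andP[p2 p3]] := pe.
have pO := cyl_dom _ (eta_cyl _ pe).
pose P := quadratic a b c d.
pose dl := (u (x0, t0) - al) / 3.
have dl0 : 0 < dl by rewrite /dl; lra.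
(* Equally spaced levels between [al] and [u (x0, t0)]: the barrier [psi] equals [a2] at [(x0, t0)]
   and stays below [a1] on [D], where [P] oscillates by less than [dl]; in the past [u_ k] exceeds
   [a1]. *)
pose a1 := al + 2 * dl; pose a2 := al + dl.
have a1u : a1 < u (x0, t0) by rewrite /a1 /dl; lra.
have [e1 e10 left] := Gamma_liminf_left _ _ _ _ u_Gamma_cvg (x0, t0) a1 pO a1u.
have [e2 e20 Pnear] : exists2 e, 0 < e & forall q, enorm (q.1 - x0) < e ->
    `|q.2 - t0| < e -> `|P (x0, t0) - P q| < dl.
  apply/(nbhs_enorm_ball (x0, t0)).
  exact: (continuous_quadratic a b c d (x0, t0) _ (nbhsx_ballx _ _ dl0)).
pose gap := eta - enorm (x0 - x).
have gap0 : 0 < gap by rewrite subr_gt0.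
pose rho := Num.min (Num.min (e1 / 2) (e2 / 2)) (Num.min (gap / 2) r).
have rho0 : 0 < rho.
  by rewrite !lt_min r0 andbT; apply/andP; split; [apply/andP; split|]; rewrite divr_gt0.
have [rho1 rho2 rho3 rho4] : [/\ rho <= e1 / 2, rho <= e2 / 2, rho <= gap / 2 & rho <= r].
  by split; rewrite /rho !ge_min lexx ?orbT.
clearbody rho.
pose C0 := Num.max C 0.
have C00 : 0 <= C0 by rewrite le_max lexx orbT.
have u_C0 k q : pdom Omega T q -> `|u_ k q| <= C0.
  by move=> /(u_bounded k)/le_trans; apply; rewrite le_max lexx.
(* Chosen so that at distance [rho / 2] from [x0] the paraboloid brings the barrier below [- C0],
   hence below every [u_ k]. *)
pose A := 4 * (C0 + `|a1|) / rho ^+ 2.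
have A0 : 0 <= A by rewrite /A !mulr_ge0 ?addr_ge0 ?invr_ge0 ?sqr_ge0.
pose H := C0 + `|P (x0, t0)| + dl.
(* A bound for the error in [viscosity_touch] at any contact point in [D] once the weighted norm is
   at most 1; [H] bounds the contact value. It involves neither [k] nor the slope [c'], which can
   therefore be chosen after it. *)
pose E0 := (2 * A + 2 * H / (rho / 2) ^+ 2) * J
  + 2 * @tail_coef R n sigma Lambda (enorm x0 + rho) (rho / 2).
have E00 : 0 <= E0.
  apply: addr_ge0; last by rewrite mulr_ge0// tail_coef_ge0.
  have H0 : 0 <= H by rewrite addr_ge0 ?(ltW dl0)// addr_ge0.
  apply: mulr_ge0 => //; apply: addr_ge0; first exact: mulr_ge0.
  by rewrite mulr_ge0 ?invr_ge0 ?sqr_ge0// mulr_ge0.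
(* With this slope the contact inequality contradicts the lower bounds on [f_ k] and [I_ k v]. *)
pose c' := `|c - I v (x, t) - f (x, t)| + 2 * `|eps| + E0 + 1.
have c'0 : 0 < c'.
  apply: ltr_wpDl; last exact: ltr01.
  by apply: addr_ge0 => //; apply: addr_ge0 => //; exact: mulr_ge0.
pose psi q := P q + (- A) * enorm (q.1 - x0) ^+ 2 + (- c') * q.2
  + (c' * t0 + a2 - P (x0, t0)).
have cpsi : continuous psi by exact: continuous_barrier.
have [e3 e30 psi_near] : exists2 e, 0 < e & forall q, enorm (q.1 - x0) < e ->
    `|q.2 - t0| < e -> al < psi q.
  apply/(nbhs_enorm_ball (x0, t0)); apply: (cvgr_gt _ (cpsi (x0, t0))).
  by rewrite /psi /= subrr enorm0 expr0n/= /a2; lra.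
pose t1 := Num.min t (t0 + rho).
pose D := closed_pcyl x0 rho t0 t1.
have [t1t t1rho] : t1 <= t /\ t1 <= t0 + rho.
  by split; rewrite /t1 ge_min lexx ?orbT.
have D_cyl : D `<=` pcyl x eta t eta.
  move=> q [q1 /andP[q2 q3]]; split.
    have -> : q.1 - x = (q.1 - x0) + (x0 - x) by rewrite addrA subrK.
    apply: le_lt_trans (enormD _ _) _; rewrite /gap in rho3 gap0; lra.
  by rewrite (lt_le_trans p2 q2) (le_trans q3).
have D_near q : D q -> `|P (x0, t0) - P q| < dl.
  move=> [q1 /andP[q2 q3]]; apply: Pnear; first by lra.
  by rewrite ger0_norm ?subr_ge0//; lra.
pose gapt := t0 - (t - eta).
have gapt0 : 0 < gapt by rewrite subr_gt0.
exists (Num.min (Num.min e1 e3) (Num.min rho gapt)).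
  by rewrite !lt_min e10 e30 rho0.
apply: filterS3 left data (L1omega_norm_near _ ltr01) => k kleft kdata kL1 q.
rewrite !lt_min => /andP[/andP[qe1 qe3] /andP[qrho _]].
move=> /andP[/andP[te1 te3] /andP[trho tgap]] qt.
have [qt0|qt0] := leP q.2 t0.
  apply: (@lt_trans _ _ a1); first by rewrite /a1; lra.
  apply: kleft => //; apply: cyl_dom; apply: eta_cyl; split.
    have -> : q.1 - x = (q.1 - x0) + (x0 - x) by rewrite addrA subrK.
    by apply: le_lt_trans (enormD _ _) _; rewrite /gap in rho3 gap0; lra.
  move: tgap; rewrite qt andbT ltr_norml /gapt => /andP[h _]; lra.
apply: (lt_le_trans (psi_near q qe3 te3)).
have Dq : D q.
  split; first exact: ltW.
  rewrite (ltW qt0) /t1 le_min qt /=.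
  by move: trho; rewrite ltr_norml => /andP[_ h]; lra.
have psi_le q' : D q' -> psi q' <= a1 - A * enorm (q'.1 - x0) ^+ 2 - c' * (q'.2 - t0).
  move=> Dq'; have := D_near q' Dq'; rewrite ltr_norml => /andP[h _].
  by rewrite /psi /a1 /a2; lra.
have psi_a1 q' : D q' -> psi q' <= a1.
  move=> Dq'; apply: le_trans (psi_le q' Dq') _.
  have [_ /andP[h _]] := Dq'.
  have : 0 <= c' * (q'.2 - t0) by rewrite mulr_ge0 ?subr_ge0// ltW.
  have : 0 <= A * enorm (q'.1 - x0) ^+ 2 by rewrite mulr_ge0 ?sqr_ge0.
  lra.
have D_dom : D `<=` pdom Omega T by move=> q' /D_cyl/eta_cyl/cyl_dom.
have [[y s] Dz zmin] := min_attained k x0 rho t0 t1 psi D_dom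
  (ex_intro _ q Dq) cpsi.
(* The barrier exceeds [al] at [q], so it is enough that the minimum of [u_ k - psi] over [D] is
   nonnegative. A negative minimum is shown to be a contact point off the initial and lateral
   boundary. *)
rewrite -subr_ge0; apply: le_trans (zmin q Dq).
rewrite leNgt; apply/negP => zneg.
have [/= y1 /andP[s1 s2]] := Dz.
(* At time [t0] the inequality from the past gives [u_ k > a1 >= psi]. A later contact leaves room
   for a backward cylinder down to [t0]. *)
have ty : t0 < s.
  rewrite lt_neqAle s1 andbT; apply/eqP => t0s.
  have : a1 < u_ k (y, s).
    by apply: kleft; rewrite /= -?t0s ?subrr ?normr0//; [rewrite t0s; exact: D_dom|lra].
  by have := psi_a1 _ Dz; lra.
have y2 : enorm (y - x0) < rho / 2.
  rewrite ltNge; apply/negP => h.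
  have hA : C0 + `|a1| <= A * enorm (y - x0) ^+ 2.
    have -> : C0 + `|a1| = A * (rho / 2) ^+ 2 by rewrite /A; field; rewrite gt_eqF.
    by rewrite ler_wpM2l// ler_pXn2r// ?nnegrE ?enorm_ge0// ltW// divr_gt0.
  have := psi_le _ Dz; have : 0 <= c' * (s - t0) by rewrite mulr_ge0 ?subr_ge0// ltW.
  have := u_C0 k _ (D_dom _ Dz); rewrite ler_norml => /andP[h1 _].
  by have := ler_norm a1; rewrite /=; lra.
have rho20 : 0 < rho / 2 by rewrite divr_gt0.
have sub_D : pcyl y (rho / 2) s (s - t0) `<=` D.
  move=> q' [q1 /andP[q2 q3]]; split.
    have -> : q'.1 - x0 = (q'.1 - y) + (y - x0) by rewrite addrA subrK.
    by apply: le_trans (enormD _ _) _; lra.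
  rewrite (le_trans q3 s2) andbT ltW//; lra.
have sub_cyl : pcyl y (rho / 2) s (s - t0) `<=` pcyl x r t tau.
  by move=> q' /sub_D/D_cyl/eta_cyl.
have z_cyl := D_cyl _ Dz.
have sT : - T < s <= 0.
  by have [_] := D_dom _ Dz; rewrite /= in_itv.
have touch := viscosity_touch sigma Lambda T Omega sigma_range Lambda_ge1
  (I_ k) (f_ k) (u_ k) u v x r t tau a b c d (I_elliptic k) (u_super k)
  (u_C_L1 k) ulim_C_L1 v_test vE test_le J J_bound x0 y A (- c') s (rho / 2)
  (s - t0) 1 A0.
have [] := kdata _ z_cyl.
have := touch _ _ sub_cyl _ (kL1 s sT).
have -> : 0 < rho / 2 <= r by rewrite rho20/=; lra.
have -> : 0 < s - t0 by rewrite subr_gt0.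
move=> /(_ isT isT) {}touch lo1 lo2.
have {}touch : f_ k (y, s) <= c + - c' - I_ k v (y, s)
    + ((2 * A + 2 * `|u_ k (y, s) - v (y, s)| / (rho / 2) ^+ 2) * J
       + 2 * (@tail_coef R n sigma Lambda (enorm y) (rho / 2) * 1)).
  apply: touch => q' q'c; have := zmin q' (sub_D _ q'c).
  rewrite !vE; [|exact: sub_cyl|exact: eta_cyl]; rewrite /psi /P/=; lra.
have hH : `|u_ k (y, s) - v (y, s)| <= H.
  apply: le_trans (ler_normB _ _) _; rewrite /H -addrA lerD ?u_C0//; first exact: D_dom.
  rewrite vE; last exact: eta_cyl.
  have := D_near _ Dz; rewrite /P => h.
  have := ler_normB (quadratic a b c d (x0, t0))
    (quadratic a b c d (x0, t0) - quadratic a b c d (y, s)).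
  by rewrite subKr; lra.
have hE : (2 * A + 2 * `|u_ k (y, s) - v (y, s)| / (rho / 2) ^+ 2) * J
       + 2 * (@tail_coef R n sigma Lambda (enorm y) (rho / 2) * 1) <= E0.
  rewrite mulr1; apply: lerD.
    apply: ler_wpM2r => //; rewrite lerD2l ler_wpM2r ?invr_ge0 ?sqr_ge0//.
    by rewrite ler_wpM2l.
  rewrite ler_wpM2l// le_tail_coef ?enorm_ge0//.
  have -> : y = x0 + (y - x0) by rewrite addrC subrK.
  by apply: le_trans (enormD _ _) _; rewrite lerD2l.
have := ler_norm (c - I v (x, t) - f (x, t)); have := ler_norm eps.
rewrite /c' in touch; lra.
Qed.

(** A minimum point of [u_ k - v] is trapped near [(x, t)] with a value between [- del] and [del].
    The contact inequality there loses one [eps] each for [f_ k], for [I_ k v] and for the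
    ellipticity error. *)
Lemma touch_limit : 0 < eps -> f (x, t) <= c - I v (x, t) + 3 * eps.
Proof.
move=> eps_gt0; have eta_gt0 : 0 < eta := eta0; have eta_le_r : eta <= r := eta_r.
have eps0 : 0 < eps := eps_gt0.
pose P := quadratic a b c d.
(* With a quarter of [eta], the ball of radius [rho] about a point within [rho] of [x] stays within
   [eta / 2] of [x]. *)
pose rho := eta / 4; have rho0 : 0 < rho by rewrite divr_gt0.
(* The ellipticity error is at most [del * K] when both the contact value and the weighted norm are
   at most [del]. *)
pose K := 2 / rho ^+ 2 * J + 2 * @tail_coef R n sigma Lambda (enorm x + eta) rho.
have K0 : 0 <= K.
  apply: addr_ge0; last by rewrite mulr_ge0// tail_coef_ge0.
  by rewrite mulr_ge0// mulr_ge0// invr_ge0 sqr_ge0.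
pose del := eps / (1 + K).
have del0 : 0 < del by rewrite divr_gt0// ltr_pwDl.
have delK : del * K <= eps.
  have K1 : 0 < 1 + K by rewrite ltr_pwDl.
  by rewrite /del mulrAC ler_pdivrMr// ler_pM2l// lerDr.
clearbody del.
have Pxt : P (x, t) = u (x, t) by rewrite /P -vE.
pose D := closed_pcyl x (eta / 2) (t - eta / 2) t.
have D_cyl : D `<=` pcyl x eta t eta.
  move=> q [q1 /andP[q2 q3]]; split.
    by apply: le_lt_trans q1 _; lra.
  by rewrite q3 andbT; apply: lt_le_trans q2; lra.
have [z [zO zp zt zu]] := Gamma_recovery _ _ _ _ u_Gamma_cvg _ (cyl_dom _ xt_cyl).
have rec (e : R) : 0 < e -> \forall k \near \oo, u_ k (z k) - P (z k) < e.
  move=> e0; have e20 : 0 < e / 2 by rewrite divr_gt0.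
  have h1 : \forall k \near \oo, u_ k (z k) < u (x, t) + e / 2 by apply: zu; lra.
  have h2 : \forall k \near \oo, P (x, t) - e / 2 < P (z k).
    have cP : (P \o z) @ \oo --> P (x, t).
      exact: (cvg_comp _ _ zp (continuous_quadratic a b c d (x, t))).
    by apply: (cvgr_gt _ cP); rewrite /P; lra.
  by apply: filterS2 h1 h2 => k; rewrite Pxt; lra.
have zD : \forall k \near \oo, D (z k).
  have : nbhs (x, t) [set q | enorm (q.1 - x) < eta / 2 /\ `|q.2 - t| < eta / 2].
    by apply/nbhs_enorm_ball; exists (eta / 2) => //; rewrite divr_gt0.
  move=> /zp hz; have {}hz : \forall k \near \oo,
    enorm ((z k).1 - x) < eta / 2 /\ `|(z k).2 - t| < eta / 2 by exact: hz.
  apply: filterS hz => k [z1 z2]; split; first exact: ltW.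
  by rewrite (zt k) andbT; move: z2; rewrite ltr_norml => /andP[h _]; lra.
(* The second clause confines minimum points: away from [(x, t)] the difference exceeds its value at
   the recovery point [z k], which also lies in [D]. *)
have cov : \forall k \near \oo, D `<=` (fun q => - del < u_ k q - P q /\
    (rho <= enorm (q.1 - x) \/ q.2 <= t - rho ->
     u_ k (z k) - P (z k) < u_ k q - P q)).
  have /compact_near_coveringP/near_covering_withinP :=
    compact_closed_pcyl x (eta / 2) (t - eta / 2) t.
  apply => p Dp.
  have key (e : R) : 0 < e -> exists2 e', 0 < e' & \forall k \near \oo, forall q,
      enorm (q.1 - p.1) < e' -> `|q.2 - p.2| < e' -> q.2 <= t ->
      u p - P p - e < u_ k q - P q.
    move=> e0; have e20 : 0 < e / 2 by rewrite divr_gt0.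
    have lt_u : u p - e / 2 < u p by lra.
    have [e1 e10 he1] := Gamma_liminf_cyl p _ (D_cyl _ Dp) lt_u.
    have [e2 e20' he2] : exists2 e', 0 < e' & forall q, enorm (q.1 - p.1) < e' ->
        `|q.2 - p.2| < e' -> `|P p - P q| < e / 2.
      apply/nbhs_enorm_ball.
      exact: (continuous_quadratic a b c d p _ (nbhsx_ballx _ _ e20)).
    exists (Num.min e1 e2); first by rewrite lt_min e10.
    apply: filterS he1 => k hk q; rewrite !lt_min => /andP[q1 q2] /andP[q3 q4] qt.
    have := hk q q1 q3 qt; have := he2 q q2 q4; rewrite ltr_norml => /andP[h1 h2].
    by move=> h3; lra.
  (* At [(x, t)] itself [u - P] vanishes and only the bound [- del] is available; the neighbourhood
     is small enough to make the second clause vacuous. *)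
  have [pxt|pxt] := eqVneq p (x, t).
    have [e' e'0 he'] := key _ del0.
    exists ([set q | enorm (q.1 - p.1) < Num.min e' rho /\
                     `|q.2 - p.2| < Num.min e' rho],
            [set k | forall q, enorm (q.1 - p.1) < e' -> `|q.2 - p.2| < e' ->
               q.2 <= t -> u p - P p - del < u_ k q - P q]) => /=.
      split=> //; apply/nbhs_enorm_ball; exists (Num.min e' rho) => //.
      by rewrite lt_min e'0.
    move=> [q k] /= [[q1 q2] hk] [_ /andP[_ qt]].
    move: q1 q2; rewrite !lt_min => /andP[q1 q1'] /andP[q2 q2']; split.
      by have := hk q q1 q2 qt; rewrite pxt Pxt; lra.
    move: q1' q2'; rewrite pxt /= => q1' q2' [h|h].
      by move: q1'; rewrite ltNge h.
    by move: q2'; rewrite ltr_norml => /andP[h' _]; lra.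
  (* Elsewhere the contact is strict: eventually [u_ k - P] stays above half the gap near [p], and
     its value at the recovery point drops below it. *)
  have gap0 : 0 < u p - P p.
    by rewrite subr_gt0 /P -vE; [apply: v_lt => //|]; apply/eta_cyl/D_cyl.
  have gap20 : 0 < (u p - P p) / 2 by rewrite divr_gt0.
  have [e' e'0 he'] := key _ gap20.
  exists ([set q | enorm (q.1 - p.1) < e' /\ `|q.2 - p.2| < e'],
          [set k | (forall q, enorm (q.1 - p.1) < e' -> `|q.2 - p.2| < e' ->
             q.2 <= t -> u p - P p - (u p - P p) / 2 < u_ k q - P q) /\
             u_ k (z k) - P (z k) < (u p - P p) / 2]) => /=.
    split; first by apply/nbhs_enorm_ball; exists e'.
    by apply: filterI => //; exact: rec.
  move=> [q k] /= [[q1 q2] [hk hz]] [_ /andP[_ qt]].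
  by have := hk q q1 q2 qt; split; lra.
(* With [eps] fixed, a single good index [k] is enough. *)
have [k [kcov [kz [krec [kdata kL1]]]]] :=
  filter_ex (filterI cov (filterI zD (filterI (rec _ del0)
    (filterI data (L1omega_norm_near _ del0))))).
have D_dom : D `<=` pdom Omega T by move=> q' /D_cyl/eta_cyl/cyl_dom.
have [[y s] Dy ymin] := min_attained k x (eta / 2) (t - eta / 2) t P D_dom
  (ex_intro _ _ kz) (continuous_quadratic a b c d).
have [ylow yfar] := kcov _ Dy.
have [y_rho s_rho] : enorm (y - x) < rho /\ t - rho < s.
  split; rewrite ltNge; apply/negP => h.
    by have := yfar (or_introl h); rewrite ltNge ymin.
  by have := yfar (or_intror h); rewrite ltNge ymin.
have [/= _ /andP[_ st]] := Dy.
have sub_D : pcyl y rho s (s - (t - eta / 2)) `<=` D.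
  move=> q [q1 /andP[q2 q3]]; split.
    have -> : q.1 - x = (q.1 - y) + (y - x) by rewrite addrA subrK.
    by apply: le_trans (enormD _ _) _; rewrite /rho in q1 y_rho *; lra.
  by rewrite (le_trans q3 st) andbT; lra.
have sub_cyl : pcyl y rho s (s - (t - eta / 2)) `<=` pcyl x r t tau.
  by move=> q /sub_D/D_cyl/eta_cyl.
have sT : - T < s <= 0 by have [_] := D_dom _ Dy; rewrite /= in_itv.
have [lo1 lo2] := kdata _ (D_cyl _ Dy).
(* Here [v] itself, up to a constant, touches [u_ k]: the barrier parameters [A] and [c'] are 0. *)
have := viscosity_touch sigma Lambda T Omega sigma_range Lambda_ge1
  (I_ k) (f_ k) (u_ k) u v x r t tau a b c d (I_elliptic k) (u_super k)
  (u_C_L1 k) ulim_C_L1 v_test vE (test_le) J J_bound x y 0 0 s rho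
  (s - (t - eta / 2)) del (lexx 0) _ _ sub_cyl _ (kL1 s sT).
have -> : 0 < rho <= r by rewrite rho0/= /rho; lra.
have -> : 0 < s - (t - eta / 2) by rewrite /rho in s_rho; lra.
move=> /(_ isT isT) touch.
have {touch} : f_ k (y, s) <= c + 0 - I_ k v (y, s)
    + ((2 * 0 + 2 * `|u_ k (y, s) - v (y, s)| / rho ^+ 2) * J
       + 2 * (@tail_coef R n sigma Lambda (enorm y) rho * del)).
  apply: touch => q qc; have := ymin q (sub_D _ qc).
  by rewrite !vE; [|exact: sub_cyl|exact/eta_cyl/D_cyl]; rewrite /P/=; lra.
have hdel : `|u_ k (y, s) - v (y, s)| <= del.
  rewrite vE; last exact/eta_cyl/D_cyl.
  rewrite -/P ler_norml ltW//= ltW//.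
  by apply: le_lt_trans krec; exact: ymin.
have h1 : (2 * 0 + 2 * `|u_ k (y, s) - v (y, s)| / rho ^+ 2) * J <=
    del * (2 / rho ^+ 2 * J).
  rewrite mulr0 add0r (mulrC 2) -!mulrA; apply: ler_wpM2r => //.
  by rewrite mulr_ge0// mulr_ge0// invr_ge0 sqr_ge0.
have h2 : 2 * (@tail_coef R n sigma Lambda (enorm y) rho * del) <=
    del * (2 * @tail_coef R n sigma Lambda (enorm x + eta) rho).
  rewrite mulrA [leRHS]mulrC; apply: ler_wpM2r; first exact: ltW.
  apply: ler_wpM2l => //; apply: le_tail_coef => //; first exact: enorm_ge0.
  have -> : y = x + (y - x) by rewrite addrC subrK.
  by apply: le_trans (enormD _ _) _; rewrite lerD2l /rho in y_rho *; lra.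
by move: delK; rewrite /K mulrDr; lra.
Qed.

End near_touching_point.

Lemma test_function_limit : f (x, t) <= c - I v (x, t).
Proof.
apply/ler_addgt0Pr => e e0; have e30 : 0 < e / 3 by rewrite divr_gt0.
have [eta [eta0 eta_r eta_tau data]] := data_near _ e30.
(* The envelope [kappa] is common to all the operators, so ellipticity of [I_ 0] provides a moment
   bound valid for every [k]. *)
have Jlt := trunc_sqr_kappa_lty sigma Lambda sigma_range Lambda_ge1 Omega T
  (I_ 0) v x r t tau (I_elliptic 0) v_test.
pose J := fine (\int[lebesgue_tuple R n]_z
  (trunc_sqr r (vec z) * kappa sigma Lambda (vec z))%:E)%E.
have := touch_limit eta (e / 3) eta0 _ _ data J _ e30.
have -> : eta <= r by lra.
have -> : eta <= tau by lra.
move=> /(_ isT isT) touch.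
have {touch} : f (x, t) <= c - I v (x, t) + 3 * (e / 3).
  apply: touch; rewrite /J fineK// ge0_fin_numE//; apply: integral_ge0 => z _.
  by rewrite lee_fin mulr_ge0 ?trunc_sqr_ge0 ?kappa_ge0.
by lra.
Qed.


End test_function.
End stability.

Theorem theorem5p3 (R : realType) (n : nat) (n_gt0 : (0 < n)%N)
    (sigma Lambda T : R) (Omega : set 'rV[R]_n)
    (sigma_range : 0 < sigma < 2) (Lambda_ge1 : 1 <= Lambda) (T_gt0 : 0 < T)
    (Omega_nonempty : Omega !=set0) (Omega_open : open Omega)
    (Omega_connected : connected Omega)
    (I_ : nat -> operator) (I : operator)
    (u_ : nat -> 'rV[R]_n * R -> R) (u : 'rV[R]_n * R -> R)
    (f_ : nat -> 'rV[R]_n * R -> R) (f : 'rV[R]_n * R -> R)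
    (I_elliptic : forall k, elliptic sigma Lambda Omega T (I_ k))
    (u_C_L1 : forall k, C_L1omega sigma (- T) 0 (u_ k))
    (u_lsc : forall k, lsc_on pnbhs (closure Omega `*` `]- T, 0]) (u_ k))
    (u_lsc_euclidean : forall k, lsc_on nbhs (Omega `*` `]- T, 0]) (u_ k))
    (f_continuous : pcontinuous_on (Omega `*` `]- T, 0]) f)
    (u_super : forall k,
       viscosity_supersolution sigma Omega T (I_ k) (f_ k) (u_ k))
    (u_Gamma_cvg : Gamma_cvg Omega T u_ u)
    (ulim_C_L1 : C_L1omega sigma (- T) 0 u)
    (u_cvg_C_L1 : cvg_C_L1omega sigma (- T) 0 u_ u)
    (f_cvg : cvg_locally_uniformly Omega T f_ f)
    (I_cvg : weak_cvg sigma Omega T I_ I)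
    (u_bounded : exists C : R, forall k p,
       (Omega `*` `]- T, 0]) p -> `|u_ k p| <= C) :
  viscosity_supersolution sigma Omega T I f u.
Proof.
have [C u_le_C] := u_bounded.
move=> v x r t tau v_test v_touch v_lt v_out.
have [r0 tau0 _ _ [a [b [c [d vE]]]]] := v_test.
rewrite (left_time_derivative_quadratic v a b c d x t r tau)//.
exact: (test_function_limit sigma Lambda T Omega sigma_range Lambda_ge1 I_ I u_ u
  f_ f I_elliptic u_C_L1 u_lsc_euclidean f_continuous u_super u_Gamma_cvg
  ulim_C_L1 u_cvg_C_L1 f_cvg I_cvg C u_le_C v x r t tau a b c d).
Qed.
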